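(* Let $g$ be a smooth pseudo-Riemannian metric on an open set $U$ (covered by a single coordinate chart), let $\mathfrak{M}$ denote the space of smooth pseudo-Riemannian metrics on $U$, and let $p\in U$. Suppose $\{\varphi_\tau\}_{\tau\in\mathbb{R}}$ is a one-parameter family of diffeomorphisms with $\varphi_\tau(p)=p$ for all $\tau$ and such that $\lim_{\tau\to\infty}\varphi_\tau^*g=g_0\in\mathfrak{M}$. Then every polynomial curvature invariant of $g$ evaluated at $p$ equals the corresponding polynomial curvature invariant of $g_0$ evaluated at $p$.
   Context: A polynomial curvature invariant of a metric is a scalar obtained as a polynomial in full contractions (using the metric) of the Riemann curvature tensor and its covariant derivatives of arbitrary order (e.g. the Ricci scalar, $R_{\mu\nu\alpha\beta}R^{\mu\nu\alpha\beta}$). The limit $\lim_{\tau\to\infty}\varphi_\tau^*g=g_0$ is understood in the given coordinates on $U$: the components of $\varphi_\tau^*g$ and their partial derivatives converge to those of the smooth metric $g_0$. *)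

(* Defs.v *)
(* Everything is in a single global coordinate chart:
   points of U are row vectors in R^n. *)
From HB Require Import structures.
From Stdlib Require List.
From mathcomp Require Import all_boot all_order all_fingroup all_algebra.
From mathcomp Require Import all_classical all_reals all_analysis.
Set Implicit Arguments. Unset Strict Implicit. Unset Printing Implicit Defensive.
Import Order.TTheory GRing.Theory Num.Theory.
Import numFieldNormedType.Exports.
Local Open Scope classical_set_scope.
Local Open Scope ring_scope.

Section Geom.
Variables (R : realType) (n : nat).
Notation V := 'rV[R]_n.

Definition ebasis (i : 'I_n) : V := delta_mx 0 i.
Definition partial (i : 'I_n) (f : V -> R) : V -> R := fun x => 'D_(ebasis i) f x.
Definition iterpartial (l : seq 'I_n) (f : V -> R) : V -> R := foldr partial f l.

Definition smooth_on (U : set V) (f : V -> R) : Prop :=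
  forall (l : seq 'I_n) (x : V), U x ->
    {for x, continuous (iterpartial l f)} /\
    forall i : 'I_n, derivable (iterpartial l f) x (ebasis i).

Definition smooth_map_on (U : set V) (phi : V -> V) : Prop :=
  forall a : 'I_n, smooth_on U (fun x => phi x 0 a).

Definition diffeo_on (U : set V) (phi : V -> V) : Prop :=
  smooth_map_on U phi /\ (forall x, U x -> U (phi x)) /\
  exists psi : V -> V, [/\ smooth_map_on U psi, (forall x, U x -> U (psi x)),
     (forall x, U x -> psi (phi x) = x) & (forall x, U x -> phi (psi x) = x)].

Definition metric_on (U : set V) (g : V -> 'M[R]_n) : Prop :=
  (forall a b : 'I_n, smooth_on U (fun x => g x a b)) /\
  (forall x, U x -> (g x)^T = g x /\ g x \in unitmx).

Definition pullback (phi : V -> V) (g : V -> 'M[R]_n) : V -> 'M[R]_n :=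
  fun x => \matrix_(i, j) \sum_(a < n) \sum_(b < n)
     partial i (fun y => phi y 0 a) x * partial j (fun y => phi y 0 b) x * g (phi x) a b.

Definition ginv (g : V -> 'M[R]_n) (x : V) : 'M[R]_n := invmx (g x).

Definition christoffel (g : V -> 'M[R]_n) (a b c : 'I_n) (x : V) : R :=
  2^-1 * \sum_(d < n) ginv g x a d *
    (partial b (fun y => g y d c) x + partial c (fun y => g y d b) x
     - partial d (fun y => g y b c) x).

(* Riemann tensor with all indices lowered, R_{abcd} = g_{ae} R^e_{bcd},
   R^e_{bcd} = d_c Gamma^e_{db} - d_d Gamma^e_{cb}
               + Gamma^e_{cf} Gamma^f_{db} - Gamma^e_{df} Gamma^f_{cb}.
   A covariant tensor field is a function V -> seq 'I_n -> R
   (its rank being the length of the index list). *)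
Definition riemann (g : V -> 'M[R]_n) (x : V) (s : seq 'I_n) : R :=
  match s with
  | [:: a; b; c; d] =>
      \sum_(e < n) g x a e *
        (partial c (christoffel g e d b) x - partial d (christoffel g e c b) x
         + \sum_(f < n) (christoffel g e c f x * christoffel g f d b x
                         - christoffel g e d f x * christoffel g f c b x))
  | _ => 0
  end.

Fixpoint conn_corr (g : V -> 'M[R]_n) (T : seq 'I_n -> R) (x : V) (c : 'I_n)
    (pre s : seq 'I_n) : R :=
  match s with
  | [::] => 0
  | a :: s' => \sum_(e < n) christoffel g e c a x * T (pre ++ e :: s')
               + conn_corr g T x c (rcons pre a) s'
  end.

Definition covd (g : V -> 'M[R]_n) (T : V -> seq 'I_n -> R) : V -> seq 'I_n -> R :=
  fun x s => match s with
  | [::] => 0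
  | c :: s' => partial c (fun y => T y s') x - conn_corr g (T x) x c [::] s'
  end.

Definition nabla_riemann (g : V -> 'M[R]_n) (m : nat) : V -> seq 'I_n -> R :=
  iter m (covd g) (riemann g).

(* a full contraction of nabla^{m_1}Riem (x) ... (x) nabla^{m_r}Riem is given by
   the list ms = [m_1; ...; m_r] and a perfect matching of the
   rk ms = sum_k (4 + m_k) index slots, encoded as a fixed-point-free
   involution sigma of the slots. *)
Definition rk (ms : seq nat) : nat := sumn [seq 4 + m | m <- ms].

Record contraction := Contraction {
  c_orders : seq nat;
  c_pairing : {perm 'I_(rk c_orders)} }.

Definition wf_contraction (C : contraction) : Prop :=
  forall j, c_pairing C j != j /\ c_pairing C (c_pairing C j) = j.

Fixpoint factors (g : V -> 'M[R]_n) (x : V) (ms : seq nat) (s : seq 'I_n) : R :=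
  match ms with
  | [::] => 1
  | m :: ms' => nabla_riemann g m x (take (4 + m) s) * factors g x ms' (drop (4 + m) s)
  end.

Definition eval_contraction (g : V -> 'M[R]_n) (C : contraction) (x : V) : R :=
  \sum_(t : (rk (c_orders C)).-tuple 'I_n)
     (\prod_(j : 'I_(rk (c_orders C)) | (j < c_pairing C j)%N)
        ginv g x (tnth t j) (tnth t (c_pairing C j)))
     * factors g x (c_orders C) t.

(* a polynomial curvature invariant: a polynomial (real coefficients) in full
   contractions, given as a list of monomials (coefficient, list of factors) *)
Definition curv_invariant := seq (R * seq contraction).

Definition wf_invariant (P : curv_invariant) : Prop :=
  forall mon, Stdlib.Lists.List.In mon P -> forall C, Stdlib.Lists.List.In C mon.2 -> wf_contraction C.

Definition eval_invariant (P : curv_invariant) (g : V -> 'M[R]_n) (x : V) : R :=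
  \sum_(mon <- P) mon.1 * \prod_(C <- mon.2) eval_contraction g C x.

End Geom.

(* Main.v *)
(* Polynomial curvature invariants are natural under diffeomorphisms, and their
   value at a point depends continuously on finitely many derivatives of the
   metric at that point.  As phi tau fixes p, the invariant of the pullback of g
   by phi tau, taken at p, is the constant value at p of the invariant of g, and
   it converges to the value at p of the invariant of g0.

   Naturality: with J the Jacobian of phi and h the pullback of g, the Koszul
   formula gives the transformation law d_i J = J Gamma(h)_i - B_i J with
   B_i = sum_b J^b_i (Gamma(g)_b o phi).  Differentiating it once more and
   antisymmetrising, using the symmetry of second derivatives, gives the
   transformation law of the Riemann tensor; used together with the Leibniz rule
   it shows that covariant differentiation commutes with pulling back. *)
Require Import Defs.
From HB Require Import structures.
From mathcomp Require Import all_boot all_order all_fingroup all_algebra.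
From mathcomp Require Import all_classical all_reals all_analysis.
From mathcomp Require Import ring lra.
Import Order.TTheory GRing.Theory Num.Theory.
Import numFieldNormedType.Exports.
Local Open Scope classical_set_scope.
Local Open Scope ring_scope.
Set Implicit Arguments. Unset Strict Implicit. Unset Printing Implicit Defensive.

(** * Mean value theorem, chain rule and symmetry of second derivatives *)

(** [smooth_on] provides continuous iterated partial derivatives but no total derivative, so the
    chain rule and the symmetry of second derivatives are obtained from the mean value theorem along
    coordinate directions. The maps [phi tau] and their Jacobians may diverge as [tau] grows; only
    the pulled-back metrics converge. The limit argument therefore works with metrics alone, and
    Jacobians occur only in identities at a fixed [tau]. Nondegeneracy of [g0] is what makes the
    inverse metrics converge. All tensors have lowered indices, so they transform by [J] and never
    by its inverse. The inverse diffeomorphism makes [J] invertible, whence J h^-1 J^T = g^-1 for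
    the pullback h, and this absorbs the factors [J] in every full contraction. *)

Section MeanValue.
Context {R : realType}.

Lemma is_derive_line (W : normedModType R) (f : W -> R) (x v : W) (r : R) :
  derivable f (x + r *: v) v ->
  is_derive r 1 (fun s : R => f (x + s *: v)) ('D_v f (x + r *: v)).
Proof.
move=> df.
have E : (fun h : R => h^-1 *: (((fun s : R => f (x + s *: v)) \o shift r) (h *: 1)
     - f (x + r *: v))) =
   (fun h : R => h^-1 *: ((f \o shift (x + r *: v)) (h *: v) - f (x + r *: v))).
  apply/funext => h /=; congr (_ *: (f _ - _)).
  by rewrite [h *: 1]mulr1 scalerDl addrCA.
apply: DeriveDef; first by rewrite /derivable E.
by rewrite /derive E.
Qed.

(** The one-variable mean value theorem on the segment between 0 and [h]. Bounding [c] by the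
    absolute value of [h] covers both signs of [h] in one statement. *)
Lemma MVT_line (W : normedModType R) (f : W -> R) (x v : W) (h : R) :
  (forall r : R, `|r| <= `|h| -> derivable f (x + r *: v) v) ->
  exists2 c : R, `|c| <= `|h| & f (x + h *: v) - f x = h * 'D_v f (x + c *: v).
Proof.
move=> df; pose w s := f (x + s *: v).
have dw (r : R) : `|r| <= `|h| -> is_derive r 1 w ('D_v f (x + r *: v)).
  by move=> rh; exact/is_derive_line/df.
have w0 : w 0 = f x by rewrite /w scale0r addr0.
have cw (a b : R) : (forall r, r \in `[a, b] -> `|r| <= `|h|) ->
    {within `[a, b], continuous w}.
  move=> ab; apply: derivable_within_continuous => r rab.
  by have [] := dw r (ab r rab).
have oc a b r : r \in `]a, b[ -> r \in `[a, b :> R].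
  by apply: subset_itv_oo_cc.
case: (leP 0 h) => h0.
  have I r : r \in `[0, h] -> `|r| <= `|h|.
    by rewrite in_itv /= => /andP[r0 rh]; rewrite !ger0_norm.
  have [c /I ch E] := MVT_segment h0 (fun r rh => dw r (I r (oc _ _ _ rh))) (cw _ _ I).
  by exists c => //; rewrite -w0 -/(w h) E subr0 mulrC.
have I r : r \in `[h, 0] -> `|r| <= `|h|.
  by rewrite in_itv /= => /andP[r0 rh]; rewrite !ler0_norm ?lerN2 // ltW.
have [c /I ch E] := MVT_segment (ltW h0) (fun r rh => dw r (I r (oc _ _ _ rh))) (cw _ _ I).
by exists c => //; rewrite -w0 -/(w h) -opprB E sub0r mulrN opprK mulrC.
Qed.

End MeanValue.

Section PartialDerivatives.
Context {R : realType} {n : nat}.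
Local Notation V := 'rV[R]_n.
Implicit Types (U : set V) (f g : V -> R).

Lemma rV_norm_le (u v : V) :
  (forall j, `|u 0 j| <= `|v 0 j|) -> `|u| <= `|v|.
Proof.
move=> uv; rewrite {1}/Num.Def.normr /= mx_normrE.
apply: bigmax_le => [|[i j] _] /=; first exact: normr_ge0.
rewrite ord1; apply: le_trans (uv j) _.
rewrite {2}/Num.Def.normr /= mx_normrE.
exact: (le_bigmax _ (fun ij : 'I_1 * 'I_n => `|v ij.1 ij.2|) (0, j)).
Qed.

Lemma near_open U f g x : open U -> U x -> (forall y, U y -> f y = g y) ->
  {near x, f =1 g}.
Proof.
move=> oU Ux fg; have : nbhs x U by exact: open_nbhs_nbhs.
by apply: filterS => y /fg.
Qed.

Lemma eq_partial_open U f g i x : open U -> U x ->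
  (forall y, U y -> f y = g y) -> partial i f x = partial i g x.
Proof. by move=> oU Ux fg; apply: near_eq_derive; exact: near_open fg. Qed.

Lemma eq_derivable_open U f g x v : open U -> U x ->
  (forall y, U y -> f y = g y) -> derivable f x v -> derivable g x v.
Proof. by move=> oU Ux fg; apply: near_eq_derivable; exact: near_open fg. Qed.

Lemma eq_continuous_open U f g x : open U -> U x ->
  (forall y, U y -> f y = g y) -> {for x, continuous f} -> {for x, continuous g}.
Proof.
move=> oU Ux fg; rewrite /prop_for /continuous_at -(fg x Ux).
exact: (cvg_trans (near_eq_cvg (near_open oU Ux fg))).
Qed.

(** Telescoping along the path from [y] to [y + d] that changes one coordinate at a time: [D k]
    keeps the first [k] coordinates of [d], and each leg is one use of [MVT_line]. The norm is the
    maximum of the entries, so the path does not leave the ball of radius [|d|]. *)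
Lemma mean_value_coordinates f (y : V) (r : R) (d : V) :
  (forall z, `|z - y| < r -> forall a, derivable f z (ebasis R a)) -> `|d| < r ->
  exists2 xi : 'I_n -> V, (forall a, `|xi a| <= `|d|) &
    f (y + d) - f y = \sum_a d 0 a * partial a f (y + xi a).
Proof.
move=> df dr; pose D k : V := \row_j (if (j < k)%N then d 0 j else 0).
have Dle (a : 'I_n) (c : R) : `|c| <= `|d 0 a| -> `|D a + c *: ebasis R a| <= `|d|.
  move=> cd; apply: rV_norm_le => j; rewrite !mxE /=.
  case: eqVneq => [->|ja]; first by rewrite ltnn add0r mulr1.
  by rewrite mulr0 addr0; case: ifP; rewrite ?normr0.
have DS (a : 'I_n) : D a.+1 = D a + d 0 a *: ebasis R a.
  apply/rowP => j; rewrite !mxE /= ltnS leq_eqVlt -val_eqE /=.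
  by case: eqVneq => [/val_inj ->|ja] /=; rewrite ?ltnn ?mulr1 ?mulr0 ?add0r ?addr0.
have step (a : 'I_n) : exists xi : V, `|xi| <= `|d| /\
    f (y + D a.+1) - f (y + D a) = d 0 a * partial a f (y + xi).
  have [|c cd E] := @MVT_line _ _ f (y + D a) (ebasis R a) (d 0 a).
    move=> c cd; apply: df; apply: le_lt_trans dr.
    by rewrite -[y + D a + _]addrA [y + _]addrC addrK; exact: Dle.
  exists (D a + c *: ebasis R a); split; first exact: Dle.
  by rewrite DS !addrA E.
have [xi xiP] := choice step.
exists xi => [a|]; first by have [] := xiP a.
have D0 : D 0%N = 0 by apply/rowP => j; rewrite !mxE.
have Dn : D n = d by apply/rowP => j; rewrite !mxE ltn_ord.
rewrite -[in LHS]Dn -[in f y](addr0 y) -D0 -(telescope_sumr (fun k => f (y + D k))) //.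
by rewrite big_mkord; apply: eq_bigr => a _; have [] := xiP a.
Qed.

Lemma cvg_squeeze_shift (W : normedModType R) (T : Type) (F : set_system T) {FF : Filter F}
    (xi : T -> W) (d : T -> R) (y : W) :
  (forall t, `|xi t| <= d t) -> d t @[t --> F] --> (0 : R) -> y + xi t @[t --> F] --> y.
Proof.
move=> xd d0; rewrite -[X in _ --> X]addr0; apply: cvgD; first exact: cvg_cst.
apply/cvgr0Pnorm_le => e e0.
move/cvgr0Pnorm_le : d0 => /(_ e e0); apply: filterS => t; apply: le_trans.
exact: le_trans (xd t) (ler_norm _).
Qed.

(** The difference quotient of the composite is, by [mean_value_coordinates], a sum of partial
    derivatives of [f] at intermediate points times difference quotients of the coordinates of
    [phi]. The intermediate points tend to [phi x], where the partial derivatives are continuous. *)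
Lemma is_derive_comp_partial U (W : normedModType R) f (phi : W -> V) (x v : W) :
  open U -> U (phi x) ->
  (forall z, U z -> forall a, derivable f z (ebasis R a)) ->
  (forall a, {for phi x, continuous (partial a f)}) ->
  (forall a, derivable (fun y => phi y 0 a) x v) ->
  is_derive x v (f \o phi)
    (\sum_a partial a f (phi x) * 'D_v (fun y => phi y 0 a) x).
Proof.
move=> oU Ux df cf dphi.
have /nbhs_ballP[r /= r0 rU] : nbhs (phi x) U by exact: open_nbhs_nbhs.
have {}df z : `|z - phi x| < r -> forall a, derivable f z (ebasis R a).
  by move=> zr; apply: df; apply: rU; rewrite -ball_normE /= distrC.
(* Outside the ball the points get the default value 0, so that the norm bound holds for every [d]
   and the squeeze applies without a side condition. *)
have /choice[xi xiP] : forall d : V, exists xi : 'I_n -> V, (forall a, `|xi a| <= `|d|) /\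
    (`|d| < r -> f (phi x + d) - f (phi x) = \sum_a d 0 a * partial a f (phi x + xi a)).
  move=> d; case: (ltP `|d| r) => dr; last first.
    by exists (fun _ => 0); split => // a; rewrite normr0.
  by have [xi ? ?] := mean_value_coordinates df dr; exists xi.
pose d h := phi (h *: v + x) - phi x.
have d0 : d h @[h --> (0 : R)^'] --> (0 : V).
  have dphi' : derivable phi x v.
    by apply/derivable_mxP => i j; rewrite ord1; exact: dphi.
  have /derivable1P/derivable1_diffP/differentiable_continuous/continuous_withinNx := dphi'.
  rewrite scale0r add0r => cphi.
  by rewrite -(subrr (phi x)); apply: cvgB => //; exact: cvg_cst.
have nd0 : `|d h| @[h --> (0 : R)^'] --> (0 : R)  by have /cvg_norm := d0; rewrite normr0.
have L : h^-1 *: ((f \o phi \o shift x) (h *: v) - (f \o phi) x) @[h --> (0 : R)^']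
   --> \sum_a partial a f (phi x) * 'D_v (fun y => phi y 0 a) x.
  apply: (@cvg_trans _ ((fun h : R => \sum_a partial a f (phi x + xi (d h) a)
      * (h^-1 *: (((fun y => phi y 0 a) \o shift x) (h *: v) - phi x 0 a))) @ (0 : R)^')).
    apply: near_eq_cvg; near=> h.
    have dr : `|d h| < r.
      near: h; move/cvgr0Pnorm_lt : d0 => /(_ r r0); exact.
    have := (xiP (d h)).2 dr; have -> : phi x + d h = phi (h *: v + x) by rewrite addrC subrK.
    move=> /= ->.
    rewrite scaler_sumr; apply: eq_bigr => a _.
    by rewrite !mxE -scalerAr [p in _ = _ *: p]mulrC.
  apply: (cvg_big (op := +%R)) => [|a _]; first exact: add_continuous.
  apply: cvgM; last exact: dphi.
  apply: continuous_cvg; first exact: cf.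
  by apply: (cvg_squeeze_shift (d := fun h => `|d h|)) => // h; exact: (xiP (d h)).1.
apply: DeriveDef; first by apply/cvg_ex; eexists; exact: L.
by apply: cvg_lim L.
Unshelve. all: by end_near. Qed.

(** Two mean value steps, one in direction [j] and then one in direction [i], express the second
    difference exactly as [h ^+ 2] times the mixed derivative at a nearby point. *)
Lemma cvg_second_difference U f i j x : open U -> U x ->
  (forall z, U z -> derivable f z (ebasis R j)) ->
  (forall z, U z -> derivable (partial j f) z (ebasis R i)) ->
  {for x, continuous (partial i (partial j f))} ->
  (h ^- 2) * (f (x + h *: ebasis R i + h *: ebasis R j) - f (x + h *: ebasis R i)
     - f (x + h *: ebasis R j) + f x) @[h --> (0 : R)^'] --> partial i (partial j f) x.
Proof.
move=> oU Ux dj dij cf.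
have /nbhs_ballP[r /= r0 rU] : nbhs x U by exact: open_nbhs_nbhs.
pose E : R := `|ebasis R i : V| + `|ebasis R j : V|.
have E0 : 0 <= E by rewrite addr_ge0.
(* Dividing [r] by [E + 1] instead of [E] avoids computing the norms of the basis vectors. *)
have E1 : 0 < E + 1 by rewrite ltr_wpDl.
have xiE (h c d : R) : `|c| <= `|h| -> `|d| <= `|h| ->
    `|d *: ebasis R i + c *: ebasis R j : V| <= `|h| * E.
  move=> ch dh; apply: le_trans (ler_normD _ _) _; rewrite !normrZ mulrDr.
  by apply: lerD; apply: ler_wpM2r.
have inU (h c d : R) : `|h| * E < r -> `|c| <= `|h| -> `|d| <= `|h| ->
    U (x + (d *: ebasis R i + c *: ebasis R j)).
  move=> hr ch dh; apply: rU; rewrite -ball_normE /= opprD addrA subrr sub0r normrN.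
  exact: le_lt_trans (xiE h c d ch dh) hr.
have /choice[xi xiP] : forall h : R, exists xi : V, `|xi| <= `|h| * E /\
    (`|h| * E < r -> f (x + h *: ebasis R i + h *: ebasis R j) - f (x + h *: ebasis R i)
     - f (x + h *: ebasis R j) + f x = h ^+ 2 * partial i (partial j f) (x + xi)).
  move=> h; case: (ltP (`|h| * E) r) => hr; last first.
    by exists 0; split => //; rewrite normr0 mulr_ge0.
  (* The second difference is the increment of [u] in direction [j], and the derivative of [u] in
     direction [j] is an increment of [partial j f] in direction [i]. *)
  pose u := (f \o shift (h *: ebasis R i)) - f.
  have du c : `|c| <= `|h| ->
      is_derive (x + c *: ebasis R j) (ebasis R j) u
        (partial j f (x + c *: ebasis R j + h *: ebasis R i)
         - partial j f (x + c *: ebasis R j)).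
    move=> ch; apply: is_deriveB; last first.
      apply/derivableP/dj.
      by have := inU h c 0 hr ch; rewrite scale0r add0r normr0; exact.
    have dU : derivable f (x + c *: ebasis R j + h *: ebasis R i) (ebasis R j).
      by apply/dj; rewrite -addrA [_ *: _ + _]addrC; exact: (inU h).
    have S : (fun k : R => k^-1 *:
         ((f \o shift (h *: ebasis R i) \o shift (x + c *: ebasis R j)) (k *: ebasis R j)
         - (f \o shift (h *: ebasis R i)) (x + c *: ebasis R j))) =
       (fun k : R => k^-1 *:
         ((f \o shift (x + c *: ebasis R j + h *: ebasis R i)) (k *: ebasis R j)
         - f (x + c *: ebasis R j + h *: ebasis R i))).
      by apply/funext => k /=; rewrite !addrA.
    apply: DeriveDef; first by rewrite /derivable S.
    by rewrite /derive S.
  have [|c ch Ec] := @MVT_line _ _ u x (ebasis R j) h.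
    by move=> c ch; have [] := du c ch.
  have [|d dh Ed] := @MVT_line _ _ (partial j f) (x + c *: ebasis R j) (ebasis R i) h.
    by move=> d dh; apply: dij; rewrite -addrA [_ *: _ + _]addrC; exact: (inU h).
  exists (d *: ebasis R i + c *: ebasis R j); split; first exact: xiE.
  move=> _; rewrite [d *: _ + _]addrC addrA -[partial i _ _]/('D_(ebasis R i) (partial j f) _).
  rewrite expr2 -mulrA -Ed.
  have <- := @derive_val _ _ _ _ _ _ _ (du c ch).
  have uE z : u z = f (z + h *: ebasis R i) - f z by [].
  by rewrite -Ec !uE [x + _ + h *: ebasis R i]addrAC; ring.
apply: (@cvg_trans _ ((fun h : R => partial i (partial j f) (x + xi h)) @ (0 : R)^')).
  apply: near_eq_cvg; near=> h.
  have h0 : h != 0 by near: h; exact: nbhs_dnbhs_neq.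
  rewrite (xiP h).2; first by rewrite mulKf // expf_neq0.
  have : `|h| < r / (E + 1) by near: h; apply: dnbhs0_lt; rewrite divr_gt0.
  rewrite ltr_pdivlMr //; apply: le_lt_trans; apply: ler_wpM2l => //.
  by rewrite lerDl.
apply: continuous_cvg; first exact: cf.
apply: (cvg_squeeze_shift (d := fun h : R => `|h| * E)) => [h|]; first exact: (xiP h).1.
rewrite -[X in _ --> X](mul0r E); apply: cvgM; last exact: cvg_cst.
have /cvg_norm : h @[h --> (0 : R)^'] --> (0 : R) by exact: cvg_within.
by rewrite normr0.
Unshelve. all: by end_near. Qed.

(** The second difference is symmetric in [i] and [j], so both mixed derivatives are limits of the
    same quotient. *)
Lemma partialC U f i j x : open U -> U x ->
  (forall z k, U z -> derivable f z (ebasis R k)) ->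
  (forall z k l, U z -> derivable (partial k f) z (ebasis R l)) ->
  (forall k l, {for x, continuous (partial k (partial l f))}) ->
  partial i (partial j f) x = partial j (partial i f) x.
Proof.
move=> oU Ux d1 d2 c2.
have L k l := @cvg_second_difference U f k l x oU Ux
  (fun z Uz => d1 z l Uz) (fun z Uz => d2 z l k Uz) (c2 k l).
apply: cvg_unique (L i j) _ => //; apply: cvg_trans (L j i).
apply: near_eq_cvg; near=> h.
by rewrite [x + _ + h *: ebasis R i]addrAC; ring.
Unshelve. all: by end_near. Qed.

End PartialDerivatives.

(** * Smoothly converging families of functions *)

Section PartialAlgebra.
Context {R : realType} {n : nat}.
Local Notation V := 'rV[R]_n.
Implicit Types (f g : V -> R) (x : V) (i : 'I_n).

Lemma partial_cst (c : R) i x : partial i (fun _ => c) x = 0.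
Proof. exact: derive_cst. Qed.

Lemma partialD f g i x : derivable f x (ebasis R i) -> derivable g x (ebasis R i) ->
  partial i (fun y => f y + g y) x = partial i f x + partial i g x.
Proof. exact: deriveD. Qed.

Lemma partialM f g i x : derivable f x (ebasis R i) -> derivable g x (ebasis R i) ->
  partial i (fun y => f y * g y) x = partial i f x * g x + f x * partial i g x.
Proof. by move=> df dg; rewrite addrC [partial i f x * _]mulrC; exact: deriveM. Qed.

Lemma derivable_bigsum (I : Type) (r : seq I) (P : pred I) (f : I -> V -> R) x v :
  (forall j, derivable (f j) x v) ->
  derivable (fun y => \sum_(j <- r | P j) f j y) x v.
Proof.
move=> df; rewrite (_ : (fun y => _) = \sum_(j <- r | P j) f j); last first.
  by apply/funext => y; rewrite fct_sumE.
elim/big_ind: _ => [|g1 g2 dg1 dg2|j _]; last exact: df.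
  exact: derivable_cst.
exact: derivableD.
Qed.

Lemma partial_sum (I : Type) (r : seq I) (P : pred I) (f : I -> V -> R) i x :
  (forall j, derivable (f j) x (ebasis R i)) ->
  partial i (fun y => \sum_(j <- r | P j) f j y) x = \sum_(j <- r | P j) partial i (f j) x.
Proof.
move=> df; elim: r => [|j r IH].
  by rewrite big_nil -[RHS](partial_cst 0 i x); congr partial; apply/funext => y; rewrite big_nil.
have := partialD (df j) (derivable_bigsum (r := r) (P := P) df).
rewrite big_cons -IH; case: ifP => Pj; last first.
  by move=> _; congr partial; apply/funext => y; rewrite big_cons Pj.
by move=> <-; congr partial; apply/funext => y; rewrite big_cons Pj.
Qed.

End PartialAlgebra.

Section Families.
Context {R : realType} {n : nat}.
Local Notation V := 'rV[R]_n.
Variables (U : set V) (T : Type) (F : set_system T) (t0 : T).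

(* The index t0 stands for the limit along F, so that a family and its limit are
   treated at once; smoothness of a single function is the case of a constant
   family. *)
Fixpoint Cfamily (k : nat) (f : T -> V -> R) : Prop :=
  (forall x, U x -> (forall t, {for x, continuous (f t)}) /\
     f t x @[t --> F] --> f t0 x) /\
  if k is k'.+1 then
    forall i, (forall t x, U x -> derivable (f t) x (ebasis R i)) /\
      Cfamily k' (fun t => partial i (f t))
  else True.

Definition smooth_family (f : T -> V -> R) : Prop := forall k, Cfamily k f.

Lemma smooth_family_on (f : T -> V -> R) : (forall t, smooth_on U (f t)) ->
  (forall l x, U x -> iterpartial l (f t) x @[t --> F] --> iterpartial l (f t0) x) ->
  smooth_family f.
Proof.
move=> sf cf k; elim: k f sf cf => [|k IH] f sf cf; (split;
  first by move=> x Ux; split => [t|]; [have [] := sf t [::] x Ux|exact: (cf [::])]) => // i.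
(* [foldr] applies the last index first, so an inner derivative is appended at the end of the
   list. *)
have itE l (g : V -> R) : iterpartial l (partial i g) = iterpartial (rcons l i) g.
  by rewrite /iterpartial foldr_rcons.
split => [t x Ux|]; first by have [_] := sf t [::] x Ux; apply.
apply: IH => [t l x Ux|l x Ux]; first by rewrite itE; exact: sf.
by under eq_fun do rewrite itE; rewrite itE; exact: cf.
Qed.

Context {FF : Filter F}.
Hypothesis oU : open U.

Lemma Cfamily_ext k (f g : T -> V -> R) : (forall t x, U x -> f t x = g t x) ->
  Cfamily k f -> Cfamily k g.
Proof.
elim: k f g => [|k IH] f g fg /= [cf df]; (split; first by move=> x Ux;
  have [cf1 cf2] := cf x Ux; split => [t|];
  [exact: (eq_continuous_open oU Ux (fg t) (cf1 t))
  |rewrite -fg //; under eq_fun do rewrite -fg //]) => // i.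
have [df1 df2] := df i; split => [t x Ux|].
  exact: (eq_derivable_open oU Ux (fg t) (df1 t x Ux)).
by apply: IH df2 => t x Ux; apply: eq_partial_open oU Ux _; exact: fg.
Qed.

(** The Leibniz rule leaves one factor undifferentiated; its order has to be lowered to match that
    of the other. *)
Lemma CfamilyS k f : Cfamily k.+1 f -> Cfamily k f.
Proof.
elim: k f => [|k IH] f; first by move=> [cf _]; split.
by move=> [cf df]; split => // i; have [? ?] := df i; split => //; exact: IH.
Qed.

Lemma Cfamily_cst k (c : R) : Cfamily k (fun _ _ => c).
Proof.
have H (d : R) x : U x -> (forall t : T, {for x, continuous (fun _ : V => d)}) /\
    (fun _ => d) @ F --> d.
  by move=> _; split => [t|]; [exact: cst_continuous|exact: cvg_cst].
elim: k c => [|k IH] c; (split; first exact: H) => // i.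
split => [t x Ux|]; first exact: derivable_cst.
by apply: (@Cfamily_ext _ (fun _ _ => 0)) => [t x _|]; first by rewrite partial_cst.
Qed.

Lemma CfamilyD k f g : Cfamily k f -> Cfamily k g -> Cfamily k (fun t x => f t x + g t x).
Proof.
have H f' g' : Cfamily 0 f' -> Cfamily 0 g' -> Cfamily 0 (fun t x => f' t x + g' t x).
  move=> [cf _] [cg _]; split => // x Ux.
  have [cf1 cf2] := cf x Ux; have [cg1 cg2] := cg x Ux.
  by split => [t|]; [exact: (cvgD (cf1 t) (cg1 t))|exact: (cvgD cf2 cg2)].
elim: k f g => [|k IH] f g; first exact: H.
move=> [cf df] [cg dg]; split; first by have [] := H f g (conj cf I) (conj cg I).
move=> i; have [df1 df2] := df i; have [dg1 dg2] := dg i; split => [t x Ux|].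
  by apply: derivableD; [exact: df1|exact: dg1].
by apply: Cfamily_ext (IH _ _ df2 dg2) => t x Ux; rewrite partialD; [|exact: df1|exact: dg1].
Qed.

Lemma CfamilyM k f g : Cfamily k f -> Cfamily k g -> Cfamily k (fun t x => f t x * g t x).
Proof.
have H f' g' : Cfamily 0 f' -> Cfamily 0 g' -> Cfamily 0 (fun t x => f' t x * g' t x).
  move=> [cf _] [cg _]; split => // x Ux.
  have [cf1 cf2] := cf x Ux; have [cg1 cg2] := cg x Ux.
  by split => [t|]; [exact: (cvgM (cf1 t) (cg1 t))|exact: (cvgM cf2 cg2)].
elim: k f g => [|k IH] f g; first exact: H.
move=> Cf Cg; have [cf df] := Cf; have [cg dg] := Cg.
split; first by have [] := H f g (conj cf I) (conj cg I).
move=> i; have [df1 df2] := df i; have [dg1 dg2] := dg i; split => [t x Ux|].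
  by apply: derivableM; [exact: df1|exact: dg1].
apply: Cfamily_ext (CfamilyD (IH _ _ df2 (CfamilyS Cg)) (IH _ _ (CfamilyS Cf) dg2)).
by move=> t x Ux; rewrite partialM; [|exact: df1|exact: dg1].
Qed.

(** The derivative of 1/f is -(1/f)(1/f) times a derivative of f, which contains 1/f itself only at
    the lower order already settled by induction. *)
Lemma CfamilyV k f : (forall t x, U x -> f t x != 0) ->
  Cfamily k f -> Cfamily k (fun t x => (f t x)^-1).
Proof.
move=> f0; have H : Cfamily 0 f -> Cfamily 0 (fun t x => (f t x)^-1).
  move=> [cf _]; split => // x Ux; have [cf1 cf2] := cf x Ux.
  by split => [t|]; [exact: (cvgV (f0 t x Ux) (cf1 t))|exact: (cvgV (f0 t0 x Ux) cf2)].
elim: k => [|k IH]; first exact: H.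
move=> Cf; have [cf df] := Cf; split; first by have [] := H (conj cf I).
move=> i; have [df1 df2] := df i; split => [t x Ux|].
  by apply: derivableV; [exact: f0|exact: df1].
have IHf := IH (CfamilyS Cf).
apply: Cfamily_ext (CfamilyM (Cfamily_cst k (-1)) (CfamilyM (CfamilyM IHf IHf) df2)).
move=> t x Ux; rewrite [RHS](deriveV (f0 t x Ux)) /=; last exact: df1.
by rewrite mulN1r scaleNr expr2 invfM.
Qed.

Lemma smooth_family_ext f g : (forall t x, U x -> f t x = g t x) ->
  smooth_family f -> smooth_family g.
Proof. by move=> fg sf k; apply: Cfamily_ext (sf k). Qed.

Lemma smooth_family_cst (c : R) : smooth_family (fun _ _ => c).
Proof. by move=> k; exact: Cfamily_cst. Qed.

Lemma smooth_familyD f g :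
  smooth_family f -> smooth_family g -> smooth_family (fun t x => f t x + g t x).
Proof. by move=> sf sg k; exact: CfamilyD. Qed.

Lemma smooth_familyM f g :
  smooth_family f -> smooth_family g -> smooth_family (fun t x => f t x * g t x).
Proof. by move=> sf sg k; exact: CfamilyM. Qed.

Lemma smooth_familyN f : smooth_family f -> smooth_family (fun t x => - f t x).
Proof.
move=> sf; apply: smooth_family_ext (smooth_familyM (smooth_family_cst (-1)) sf).
by move=> t x _; rewrite mulN1r.
Qed.

Lemma smooth_familyB f g :
  smooth_family f -> smooth_family g -> smooth_family (fun t x => f t x - g t x).
Proof. by move=> sf /smooth_familyN; exact: smooth_familyD. Qed.

Lemma smooth_familyV f : (forall t x, U x -> f t x != 0) ->
  smooth_family f -> smooth_family (fun t x => (f t x)^-1).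
Proof. by move=> f0 sf k; exact: CfamilyV. Qed.

Lemma smooth_family_partial i f :
  smooth_family f -> smooth_family (fun t => partial i (f t)).
Proof. by move=> sf k; have [_ /(_ i)[]] := sf k.+1. Qed.

Lemma smooth_family_sum (I : Type) (r : seq I) (P : pred I) (f : I -> T -> V -> R) :
  (forall i, P i -> smooth_family (f i)) ->
  smooth_family (fun t x => \sum_(i <- r | P i) f i t x).
Proof.
move=> sf; elim: r => [|i r IH].
  by apply: smooth_family_ext (smooth_family_cst 0) => t x _; rewrite big_nil.
case Pi: (P i); last by apply: smooth_family_ext IH => t x _; rewrite big_cons Pi.
by apply: smooth_family_ext (smooth_familyD (sf i Pi) IH) => t x _; rewrite big_cons Pi.
Qed.

Lemma smooth_family_prod (I : Type) (r : seq I) (P : pred I) (f : I -> T -> V -> R) :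
  (forall i, P i -> smooth_family (f i)) ->
  smooth_family (fun t x => \prod_(i <- r | P i) f i t x).
Proof.
move=> sf; elim: r => [|i r IH].
  by apply: smooth_family_ext (smooth_family_cst 1) => t x _; rewrite big_nil.
case Pi: (P i); last by apply: smooth_family_ext IH => t x _; rewrite big_cons Pi.
by apply: smooth_family_ext (smooth_familyM (sf i Pi) IH) => t x _; rewrite big_cons Pi.
Qed.

Lemma smooth_family_cvg f x : smooth_family f -> U x -> f t x @[t --> F] --> f t0 x.
Proof. by move=> sf Ux; have [/(_ x Ux)[]] := sf 0. Qed.

Lemma smooth_family_continuous f t x : smooth_family f -> U x -> {for x, continuous (f t)}.
Proof. by move=> sf Ux; have [/(_ x Ux)[]] := sf 0. Qed.

Lemma smooth_family_derivable f t i x : smooth_family f -> U x ->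
  derivable (f t) x (ebasis R i).
Proof. by move=> sf Ux; have [_ /(_ i)[+ _]] := sf 1; exact. Qed.

(** * Curvature invariants of a smoothly converging family of metrics *)

Section Curvature.
Variable G : T -> V -> 'M[R]_n.
Hypothesis sG : forall a b, smooth_family (fun t x => G t x a b).
Hypothesis uG : forall t x, U x -> G t x \in unitmx.

Lemma smooth_family_det m (M : T -> V -> 'M[R]_m) :
  (forall a b, smooth_family (fun t x => M t x a b)) ->
  smooth_family (fun t x => \det (M t x)).
Proof.
move=> sM; apply: smooth_family_sum => s _; apply: smooth_familyM.
  exact: smooth_family_cst.
by apply: smooth_family_prod.
Qed.

(** Cramer's rule: an entry of the inverse is a polynomial in the entries of the metric divided by
    the nowhere vanishing determinant. *)
Lemma smooth_family_ginv a b : smooth_family (fun t x => ginv (G t) x a b).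
Proof.
have sV : smooth_family (fun t x => (\det (G t x))^-1).
  apply: smooth_familyV (smooth_family_det sG) => t x Ux.
  by rewrite -unitfE -unitmxE uG.
have sA : smooth_family (fun t x => (\adj (G t x)) a b).
  apply: smooth_family_ext (_ : smooth_family (fun t x =>
    (-1) ^+ (b + a) * \det (row' b (col' a (G t x))))) => [t x _|].
    by rewrite mxE.
  apply: smooth_familyM; first exact: smooth_family_cst.
  apply: smooth_family_det => c d.
  by apply: smooth_family_ext (sG (lift b c) (lift a d)) => t x _; rewrite !mxE.
apply: smooth_family_ext (smooth_familyM sV sA) => t x Ux.
by rewrite /ginv /invmx uG // !mxE.
Qed.

Lemma smooth_family_christoffel a b c : smooth_family (fun t => christoffel (G t) a b c).
Proof.
apply: smooth_familyM; first exact: smooth_family_cst.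
apply: smooth_family_sum => d _; apply: smooth_familyM; first exact: smooth_family_ginv.
have pG i e f : smooth_family (fun t => partial i (fun y => G t y e f)).
  exact: (smooth_family_partial i (sG e f)).
by apply: smooth_familyB; [apply: smooth_familyD|].
Qed.

Lemma smooth_family_riemann s : smooth_family (fun t x => riemann (G t) x s).
Proof.
case: s => [|a [|b [|c [|d [|? ?]]]]]; try exact: smooth_family_cst.
apply: smooth_family_sum => e _; apply: smooth_familyM; first exact: sG.
apply: smooth_familyD.
  by apply: smooth_familyB; apply: smooth_family_partial; exact: smooth_family_christoffel.
apply: smooth_family_sum => f _.
by apply: smooth_familyB; apply: smooth_familyM; exact: smooth_family_christoffel.
Qed.

Lemma smooth_family_covd (S : T -> V -> seq 'I_n -> R) :
  (forall s, smooth_family (fun t x => S t x s)) ->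
  forall s, smooth_family (fun t x => covd (G t) (S t) x s).
Proof.
move=> sS [|c s]; first exact: smooth_family_cst.
apply: smooth_familyB; first exact: (smooth_family_partial c (sS s)).
(* [conn_corr] moves the indices already visited into its prefix, so the induction has to run over
   all prefixes. *)
elim: s [::] => [|a s IH] pre /=; first exact: smooth_family_cst.
apply: smooth_familyD; last exact: IH.
apply: smooth_family_sum => e _; apply: smooth_familyM; last exact: sS.
exact: smooth_family_christoffel.
Qed.

Lemma smooth_family_nabla_riemann m s :
  smooth_family (fun t x => nabla_riemann (G t) m x s).
Proof.
elim: m s => [|m IH] s; first exact: smooth_family_riemann.
exact: (smooth_family_covd (S := fun t => nabla_riemann (G t) m)).
Qed.

Lemma smooth_family_factors ms s : smooth_family (fun t x => factors (G t) x ms s).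
Proof.
elim: ms s => [|m ms IH] s; first exact: smooth_family_cst.
by apply: smooth_familyM; [exact: smooth_family_nabla_riemann|exact: IH].
Qed.

Lemma smooth_family_invariant (P : curv_invariant R) :
  smooth_family (fun t => eval_invariant P (G t)).
Proof.
apply: smooth_family_sum => mon _; apply: smooth_familyM; first exact: smooth_family_cst.
apply: smooth_family_prod => C _; apply: smooth_family_sum => s _.
apply: smooth_familyM; last exact: smooth_family_factors.
by apply: smooth_family_prod => j _; exact: smooth_family_ginv.
Qed.

End Curvature.

End Families.

(** * Single smooth functions and their compositions *)

Section Smooth.
Context {R : realType} {n : nat}.
Local Notation V := 'rV[R]_n.
Variable U : set V.
Hypothesis oU : open U.

Definition smooth (f : V -> R) := smooth_family U (globally [set: unit]) tt (fun _ => f).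

Lemma smooth_on_smooth f : smooth_on U f -> smooth f.
Proof. by move=> sf; apply: smooth_family_on => // l x Ux; exact: cvg_cst. Qed.

Lemma smooth_derivable f i x : smooth f -> U x -> derivable f x (ebasis R i).
Proof. by move=> sf Ux; exact: (smooth_family_derivable (t := tt) sf Ux). Qed.

Lemma smooth_continuous f x : smooth f -> U x -> {for x, continuous f}.
Proof. by move=> sf Ux; exact: (smooth_family_continuous (t := tt) sf Ux). Qed.

Lemma smooth_partial f i : smooth f -> smooth (partial i f).
Proof. by move=> sf; exact: (smooth_family_partial i sf). Qed.

Lemma smooth_smooth_on f : smooth f -> smooth_on U f.
Proof.
move=> sf l x Ux; have sl : smooth (iterpartial l f).
  by elim: l => //= i l; exact: smooth_partial.
by split => [|i]; [exact: smooth_continuous|exact: smooth_derivable].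
Qed.

Lemma smooth_ext f g : (forall x, U x -> f x = g x) -> smooth f -> smooth g.
Proof. by move=> fg; apply: smooth_family_ext => // _; exact: fg. Qed.

Lemma smoothM f g : smooth f -> smooth g -> smooth (fun x => f x * g x).
Proof. exact: smooth_familyM. Qed.

Lemma smooth_sum (I : Type) (r : seq I) (f : I -> V -> R) :
  (forall i, smooth (f i)) -> smooth (fun x => \sum_(i <- r) f i x).
Proof. by move=> sf; apply: smooth_family_sum => // i _; exact: sf. Qed.

Lemma smooth_partialC f i j x : smooth f -> U x ->
  partial i (partial j f) x = partial j (partial i f) x.
Proof.
move=> sf Ux; have Ux' := Ux; apply: partialC oU Ux' _ _ _ => [z k Uz|z k l Uz|k l].
- exact: smooth_derivable.
- exact: (smooth_derivable (smooth_partial k sf) Uz).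
- exact: (smooth_continuous (smooth_partial k (smooth_partial l sf)) Ux).
Qed.

Lemma continuous_coord (W : topologicalType) (phi : W -> V) x :
  (forall a, {for x, continuous (fun y => phi y 0 a)}) -> {for x, continuous phi}.
Proof.
move=> cphi; apply/cvgrPdist_le => /= e e0; near=> y.
rewrite /Num.Def.normr /= mx_normrE (bigmax_le _ (ltW e0)) //= => -[i j] _.
rewrite ord1 !mxE /=; move: j; near: y; apply: filter_forall => j.
exact: ((cvgrPdist_le _ _).1 (cphi j)).
Unshelve. all: by end_near. Qed.

Section Composition.
Variable phi : V -> V.
Hypotheses (sphi : forall a, smooth (fun y => phi y 0 a)).
Hypothesis phiU : forall x, U x -> U (phi x).

Lemma is_derive_comp_smooth f i x : smooth f -> U x ->
  is_derive x (ebasis R i) (f \o phi)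
    (\sum_a partial a f (phi x) * partial i (fun y => phi y 0 a) x).
Proof.
move=> sf Ux; apply: (is_derive_comp_partial oU (phiU Ux)) => [z Uz a|a|a].
- exact: smooth_derivable.
- by apply: smooth_continuous (phiU Ux); exact: smooth_partial.
- exact: smooth_derivable.
Qed.

Lemma partial_comp f i x : smooth f -> U x -> partial i (f \o phi) x =
  \sum_a partial a f (phi x) * partial i (fun y => phi y 0 a) x.
Proof. by move=> sf Ux; have [] := is_derive_comp_smooth i sf Ux. Qed.

(** Induction on the order, for all [f] at once: a derivative of [f \o phi] is a sum of products of
    [partial a f \o phi], covered by the induction hypothesis, with a derivative of a coordinate of
    [phi]. *)
Lemma smooth_comp f : smooth f -> smooth (f \o phi).
Proof.
move=> sf k; elim: k f sf => [|k IH] f sf; (split;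
  first by move=> x Ux; split => [_|]; [apply: continuous_comp;
   [apply: continuous_coord => a; exact: smooth_continuous
   |exact: smooth_continuous (phiU Ux)] | exact: cvg_cst]) => // i.
split => [_ x Ux|]; first by have [] := is_derive_comp_smooth i sf Ux.
apply: (Cfamily_ext _ (f := fun _ x => \sum_a (partial a f \o phi) x *
   partial i (fun y => phi y 0 a) x)) => [//|_ x Ux|]; first by rewrite partial_comp.
(* [smooth_family_sum] speaks of all orders at once. Here the order is fixed at [k], so the sum is
   built up term by term over an arbitrary list. *)
suff H (r : seq 'I_n) : Cfamily U (globally [set: unit]) tt k
    (fun _ x => \sum_(a <- r) (partial a f \o phi) x * partial i (fun y => phi y 0 a) x).
  exact: H.
elim: r => [|a r IHr].
  apply: (Cfamily_ext oU (f := fun _ _ => 0)); last exact: Cfamily_cst.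
  by move=> _ x _; rewrite big_nil.
have sa : Cfamily U (globally [set: unit]) tt k
    (fun _ x => (partial a f \o phi) x * partial i (fun y => phi y 0 a) x).
  apply: CfamilyM => //; first by apply: IH; exact: smooth_partial.
  by apply: (smooth_family_partial i); exact: sphi.
apply: (Cfamily_ext oU _ (CfamilyD oU sa IHr)).
by move=> _ x _; rewrite big_cons.
Qed.

End Composition.

End Smooth.

(** * Pulling back covariant tensors and contracting them *)

Section Pull.
Context {R : comPzRingType} {n : nat}.
Implicit Types (J : 'M[R]_n) (S : seq 'I_n -> R) (s : seq 'I_n).

(** This is the multilinear form with components [S], evaluated on the columns of [J] listed in
    [s]. *)
Fixpoint pull J S s : R :=
  if s is i :: s' then \sum_a J a i * pull J (fun u => S (a :: u)) s' else S [::].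

Lemma eq_pull J S S' s : (forall u, size u = size s -> S u = S' u) ->
  pull J S s = pull J S' s.
Proof.
elim: s S S' => [|i s IH] S S' eS /=; first exact: eS.
by apply: eq_bigr => a _; congr (_ * _); apply: IH => u us; apply: eS; rewrite /= us.
Qed.

Lemma pullD J S S' s : pull J (fun u => S u + S' u) s = pull J S s + pull J S' s.
Proof.
elim: s S S' => [|i s IH] S S' //=.
by rewrite -big_split /=; apply: eq_bigr => a _; rewrite IH mulrDr.
Qed.

Lemma pullZ J (c : R) S s : pull J (fun u => c * S u) s = c * pull J S s.
Proof.
elim: s S => [|i s IH] S //=.
by rewrite mulr_sumr; apply: eq_bigr => a _; rewrite IH mulrCA.
Qed.

Lemma pull_sum J (I : Type) (r : seq I) (P : pred I) (c : I -> R) (S : I -> seq 'I_n -> R) s :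
  pull J (fun u => \sum_(e <- r | P e) c e * S e u) s = \sum_(e <- r | P e) c e * pull J (S e) s.
Proof.
elim: s S => [|i s IH] S //=.
transitivity (\sum_a \sum_(e <- r | P e) J a i * (c e * pull J (fun u => S e (a :: u)) s)).
  by apply: eq_bigr => a _; rewrite IH mulr_sumr.
rewrite exchange_big /=; apply: eq_bigr => e _; rewrite mulr_sumr.
by apply: eq_bigr => a _; rewrite mulrCA.
Qed.

Lemma pull_cat J S S' k s : (k <= size s)%N ->
  pull J (fun u => S (take k u) * S' (drop k u)) s = pull J S (take k s) * pull J S' (drop k s).
Proof.
elim: k s S => [|k IH] s S.
  by rewrite take0 drop0 -pullZ => _; apply: eq_pull => u _; rewrite take0 drop0.
case: s => [//|i s] ks /=.
by rewrite mulr_suml; apply: eq_bigr => a _; rewrite (IH s (fun u => S (a :: u)) ks) mulrA.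
Qed.

Lemma sum_tuple_recl r (E : r.+1.-tuple 'I_n -> R) :
  \sum_t E t = \sum_a \sum_(t : r.-tuple 'I_n) E [tuple of a :: t].
Proof.
rewrite pair_big /= (reindex (fun p : 'I_n * r.-tuple 'I_n => [tuple of p.1 :: p.2])) //=.
exists (fun t : r.+1.-tuple 'I_n => (thead t, [tuple of behead t])) => [[a t] _|t _] /=.
  by congr pair; apply/val_inj.
by rewrite -tuple_eta.
Qed.

(** Turns the nested sums of the recursion into one sum over multi-indices, the kind of sum that
    occurs in [eval_contraction]. *)
Lemma pull_tuple J r S (t : r.-tuple 'I_n) :
  pull J S t = \sum_(u : r.-tuple 'I_n) (\prod_j J (tnth u j) (tnth t j)) * S u.
Proof.
elim: r S t => [|r IH] S t.
  rewrite (tuple0 t) /= (big_pred1 [tuple]) => [|u]; last by rewrite [u]tuple0 /= eqxx.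
  by rewrite big_ord0 mul1r.
case/tupleP: t => i t /=; rewrite sum_tuple_recl; apply: eq_bigr => a _.
rewrite IH mulr_sumr; apply: eq_bigr => u _.
rewrite big_ord_recl !tnth0 mulrA; congr (_ * _ * _).
by apply: eq_bigr => j _; rewrite !tnthS.
Qed.

End Pull.

(** * Full contractions along a perfect matching *)

Section Matching.
Context {R : comPzRingType} {n r : nat}.
Variable sigma : {perm 'I_r}.
Hypothesis involutive_sigma : forall j, sigma j != j /\ sigma (sigma j) = j.

(** Every pair of the matching has exactly one member [j] with [j < sigma j]; reindexing by [sigma]
    carries the other members onto these. *)
Lemma prod_matching (E : 'I_r -> R) :
  \prod_j E j = \prod_(j : 'I_r | (j < sigma j)%N) (E j * E (sigma j)).
Proof.
rewrite (bigID (fun j : 'I_r => (j < sigma j)%N)) /= big_split /=; congr (_ * _).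
rewrite (reindex_inj (@perm_inj _ sigma)); apply: eq_bigl => j.
have [sj ssj] := involutive_sigma j; rewrite ssj -leqNgt leq_eqVlt.
by rewrite val_eqE eq_sym (negbTE sj).
Qed.

(** Distributivity: a tuple amounts to an independent choice of two values for each pair of the
    matching. *)
Lemma sum_prod_matching (f : 'I_r -> 'I_n -> 'I_n -> R) :
  \sum_(t : r.-tuple 'I_n) \prod_(j : 'I_r | (j < sigma j)%N) f j (tnth t j) (tnth t (sigma j)) =
  \prod_(j : 'I_r | (j < sigma j)%N) \sum_a \sum_b f j a b.
Proof.
(* Degenerate cases come first. With no slots both sides are 1; with slots but [n = 0] both are 0.
   The remaining case has an element of ['I_n] at hand as a default value. *)
case: (posnP r) => [r0|r0].
  have ord_r (j : 'I_r) : false by case: (j) => m; rewrite r0.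
  rewrite [RHS]big1 => [|j]; last by have := ord_r j.
  transitivity (\sum_(t : r.-tuple 'I_n) (1 : R)).
    by apply: eq_bigr => t _; rewrite big1 // => j; have := ord_r j.
  by rewrite big_const iter_addr_0 card_tuple card_ord r0.
case: (posnP n) => [n0|n0].
  have ord_n (a : 'I_n) : false by case: (a) => m; rewrite n0.
  rewrite big1 => [|t _]; last by have := ord_n (tnth t (Ordinal r0)).
  (* Slot 0 is the smaller member of its pair, since its partner differs from it. *)
  have [j jj] : exists j : 'I_r, (j < sigma j)%N.
    have [sj ssj] := involutive_sigma (Ordinal r0).
    by exists (Ordinal r0); rewrite lt0n; move: sj; rewrite -val_eqE.
  by rewrite (bigD1 j) //= big1 ?mul0r // => a; have := ord_n a.
pose i0 := (Ordinal n0, Ordinal n0).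
under [RHS]eq_bigr do rewrite pair_big /=.
rewrite (big_distr_big i0) /=.
(* [F] stores the two values of a pair at its smaller slot and the default elsewhere, as the
   functions indexing the distributed sum do; [G] reads them back. *)
pose F (t : r.-tuple 'I_n) : {ffun 'I_r -> 'I_n * 'I_n} :=
  [ffun j : 'I_r => if (j < sigma j)%N then (tnth t j, tnth t (sigma j)) else i0].
pose G (p : {ffun 'I_r -> 'I_n * 'I_n}) : r.-tuple 'I_n :=
  [tuple if (j < sigma j)%N then (p j).1 else (p (sigma j)).2 | j < r].
rewrite (reindex F); last first.
  exists G => [t _|p].
    apply: eq_from_tnth => j; rewrite tnth_mktuple !ffunE.
    have [sj ssj] := involutive_sigma j; rewrite ssj.
    case: ltngtP => js; [by []|by []|].
    by rewrite -(val_inj js) eqxx in sj.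
  rewrite inE => /pfamilyP[/supportP sp _]; apply/ffunP => j; rewrite !ffunE !tnth_mktuple.
  have [sj ssj] := involutive_sigma j; rewrite ssj.
  case: ifP => js; last by rewrite sp // unfold_in js.
  by rewrite js ltnNge (ltnW js) /=; case: (p j).
apply: eq_big => [t|t _].
  apply/esym/pfamilyP; split => //.
  by apply/supportP => j; rewrite unfold_in ffunE => /negbTE ->.
by apply: eq_bigr => j js; rewrite ffunE js.
Qed.

(** The two factors [J] at paired slots meet the same entry of [H], so summing over the lower
    indices pair by pair replaces [H] by J H J^T. *)
Lemma contract_pull (J H : 'M[R]_n) (S : seq 'I_n -> R) :
  \sum_(t : r.-tuple 'I_n)
     (\prod_(j : 'I_r | (j < sigma j)%N) H (tnth t j) (tnth t (sigma j))) * pull J S t =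
  \sum_(t : r.-tuple 'I_n)
     (\prod_(j : 'I_r | (j < sigma j)%N) (J *m H *m J^T) (tnth t j) (tnth t (sigma j))) * S t.
Proof.
transitivity (\sum_(t : r.-tuple 'I_n) \sum_(u : r.-tuple 'I_n)
   (\prod_(j : 'I_r | (j < sigma j)%N) (H (tnth t j) (tnth t (sigma j)) *
       (J (tnth u j) (tnth t j) * J (tnth u (sigma j)) (tnth t (sigma j))))) * S u).
  apply: eq_bigr => t _; rewrite pull_tuple mulr_sumr; apply: eq_bigr => u _.
  by rewrite mulrA prod_matching -big_split.
rewrite exchange_big /=; apply: eq_bigr => u _; rewrite -mulr_suml; congr (_ * _).
rewrite (sum_prod_matching (fun j a b => H a b * (J (tnth u j) a * J (tnth u (sigma j)) b))).
apply: eq_bigr => j _; rewrite mxE exchange_big /=; apply: eq_bigr => b _.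
rewrite !mxE mulr_suml; apply: eq_bigr => a _.
by rewrite mulrA [H a b * _]mulrC.
Qed.

End Matching.

(** * Transformation laws under pullback *)

Section ChristoffelAlgebra.
Context {R : realType} {n : nat}.
Implicit Types (i j k a b c d e : 'I_n).

(** Lowering the index cancels [ginv] and leaves the Christoffel symbols of the first kind. *)
Lemma mul_metric_christoffel (g : 'rV[R]_n -> 'M[R]_n) x e b c : g x \in unitmx ->
  \sum_a g x e a * christoffel g a b c x =
  2^-1 * (partial b (fun y => g y e c) x + partial c (fun y => g y e b) x
     - partial e (fun y => g y b c) x).
Proof.
move=> ug; pose L := \col_d (partial b (fun y => g y d c) x + partial c (fun y => g y d b) x
     - partial d (fun y => g y b c) x).
transitivity (2^-1 * (g x *m (invmx (g x) *m L)) e 0); last by rewrite mulKVmx // mxE.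
rewrite mxE mulr_sumr; apply: eq_bigr => a _; rewrite mulrCA; congr (_ * (_ * _)).
by rewrite mxE; apply: eq_bigr => d _; rewrite !mxE.
Qed.

(* With J = d phi, H i j = d_i d_j phi and D a b c = d_c g_ab, the product rule says
   that P i k j is the derivative d_i of the (k, j) component of the pullback. *)
Lemma koszul (H : 'I_n -> 'I_n -> 'I_n -> R) (J g : 'I_n -> 'I_n -> R)
    (D : 'I_n -> 'I_n -> 'I_n -> R)
    (P := fun i k j => \sum_a \sum_b ((H i k a * J b j + J a k * H i j b) * g a b
        + J a k * J b j * \sum_c D a b c * J c i)) i j k :
  (forall i j, H i j = H j i) -> (forall a b, g a b = g b a) ->
  P i k j + P j k i - P k i j =
  \sum_a J a k * (2 * (\sum_b g a b * H i j b)
     + \sum_b \sum_c J b i * J c j * (D a c b + D a b c - D b c a)).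
Proof.
move=> Hsym gsym.
(* [Q] is the metric as a bilinear form and [T] collects the derivatives of the metric. Of the six
   [Q] terms on the left, four cancel by symmetry and two add up to twice [Q (J^~ k) (H i j)]. *)
pose Q (u v : 'I_n -> R) := \sum_a \sum_b u a * v b * g a b.
pose T p q r := \sum_a \sum_b \sum_c J a p * J b q * J c r * D a b c.
have Qsym u v : Q u v = Q v u.
  rewrite /Q exchange_big; apply: eq_bigr => a _; apply: eq_bigr => b _.
  by rewrite gsym [u b * _]mulrC.
have PE p q r : P p q r = Q (H p q) (J^~ r) + Q (J^~ q) (H p r) + T q r p.
  rewrite /P /Q /T -!big_split; apply: eq_bigr => a _ /=.
  rewrite -!big_split; apply: eq_bigr => b _ /=; rewrite mulrDl; congr (_ + _).
  by rewrite mulr_sumr; apply: eq_bigr => c _; ring.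
have -> : \sum_a J a k * (2 * (\sum_b g a b * H i j b)
     + \sum_b \sum_c J b i * J c j * (D a c b + D a b c - D b c a)) =
   2 * Q (J^~ k) (H i j) + (T k j i + T k i j - T i j k).
  have -> : T k j i = \sum_a \sum_b \sum_c J a k * J b i * J c j * D a c b.
    apply: eq_bigr => a _; rewrite exchange_big; apply: eq_bigr => b _.
    by apply: eq_bigr => c _; ring.
  have -> : T i j k = \sum_a \sum_b \sum_c J a k * J b i * J c j * D b c a.
    rewrite /T [RHS]exchange_big /=; apply: eq_bigr => a _.
    rewrite [RHS]exchange_big /=; apply: eq_bigr => b _.
    by apply: eq_bigr => c _; ring.
  rewrite /T /Q mulr_sumr -sumrN -!big_split; apply: eq_bigr => a _ /=.
  rewrite -sumrN -!big_split mulrDr; congr (_ + _).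
    by rewrite !mulr_sumr; apply: eq_bigr => b _; ring.
  rewrite mulr_sumr; apply: eq_bigr => b _ /=.
  rewrite -sumrN -!big_split mulr_sumr; apply: eq_bigr => c _ /=; ring.
rewrite !PE (Hsym k i) (Hsym k j) (Hsym j i) (Qsym (J^~ i)); ring.
Qed.

End ChristoffelAlgebra.

(** * Connection and curvature as matrices *)

Section MatrixCalculus.
Context {R : realType} {n : nat} (U : set 'rV[R]_n).
Hypothesis oU : open U.
Implicit Types (M N : 'rV[R]_n -> 'M[R]_n) (x : 'rV[R]_n) (i : 'I_n).

Definition mpartial i M x : 'M[R]_n := \matrix_(a, b) partial i (fun y => M y a b) x.
Definition smooth_mx M := forall a b, smooth U (fun y => M y a b).

Lemma eq_mpartial M N i x : (forall y, U y -> M y = N y) -> U x ->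
  mpartial i M x = mpartial i N x.
Proof.
move=> MN Ux; apply/matrixP => a b; rewrite !mxE.
by apply: (eq_partial_open i oU Ux) => y Uy; rewrite MN.
Qed.

Lemma mpartialB M N i x : smooth_mx M -> smooth_mx N -> U x ->
  mpartial i (fun y => M y - N y) x = mpartial i M x - mpartial i N x.
Proof.
move=> sM sN Ux; apply/matrixP => a b; rewrite !mxE.
rewrite -[RHS]deriveB; [|exact: (smooth_derivable (sM a b) Ux)
                        |exact: (smooth_derivable (sN a b) Ux)].
by congr partial; apply/funext => y; rewrite !mxE.
Qed.

Lemma mpartialM M N i x : smooth_mx M -> smooth_mx N -> U x ->
  mpartial i (fun y => M y *m N y) x = mpartial i M x *m N x + M x *m mpartial i N x.
Proof.
move=> sM sN Ux; apply/matrixP => a b; rewrite !mxE -big_split /=.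
have dM c : derivable (fun y => M y a c) x (ebasis R i).
  exact: (smooth_derivable (sM a c) Ux).
have dN c : derivable (fun y => N y c b) x (ebasis R i).
  exact: (smooth_derivable (sN c b) Ux).
rewrite (_ : (fun y => _) = fun y => \sum_c M y a c * N y c b); last first.
  by apply/funext => y; rewrite mxE.
rewrite partial_sum => [|c]; last exact: derivableM.
by apply: eq_bigr => c _; rewrite partialM // !mxE.
Qed.

Lemma smooth_mxM M N : smooth_mx M -> smooth_mx N -> smooth_mx (fun y => M y *m N y).
Proof.
move=> sM sN a b; apply: (smooth_ext oU (f := fun y => \sum_c M y a c * N y c b)).
  by move=> y _; rewrite mxE.
by apply: smooth_sum => // c; apply: smoothM.
Qed.

(** The connection form in direction [c], as a matrix in the two other indices; the quadratic terms
    of the curvature then become a commutator. *)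
Definition christoffel_mx (g : 'rV[R]_n -> 'M[R]_n) c x : 'M[R]_n :=
  \matrix_(a, b) christoffel g a c b x.

Definition curvature_mx (g : 'rV[R]_n -> 'M[R]_n) c d x : 'M[R]_n :=
  mpartial c (christoffel_mx g d) x - mpartial d (christoffel_mx g c) x
  + (christoffel_mx g c x *m christoffel_mx g d x
     - christoffel_mx g d x *m christoffel_mx g c x).

Lemma riemannE g x a b c d : riemann g x [:: a; b; c; d] = (g x *m curvature_mx g c d x) a b.
Proof.
rewrite mxE; apply: eq_bigr => e _; congr (_ * _); rewrite !mxE; congr (_ - _ + _).
- by congr partial; apply/funext => y; rewrite mxE.
- by congr partial; apply/funext => y; rewrite mxE.
- by rewrite -sumrB; apply: eq_bigr => f _; rewrite !mxE.
Qed.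

End MatrixCalculus.

Section CurvatureAlgebra.
Context {R : realType} {n : nat}.

(* The hypothesis equates d_m d_i J and d_i d_m J, both computed from
   d_i J = J Ai - Bi J, with Ami = d_m Ai and Bmi = d_m Bi. *)
Lemma curvature_conjugation (J Am Ai Bm Bi Ami Aim Bmi Bim : 'M[R]_n) :
  (J *m Am - Bm *m J) *m Ai + J *m Ami - (Bmi *m J + Bi *m (J *m Am - Bm *m J)) =
  (J *m Ai - Bi *m J) *m Am + J *m Aim - (Bim *m J + Bm *m (J *m Ai - Bi *m J)) ->
  J *m (Ami - Aim + (Am *m Ai - Ai *m Am)) = (Bmi - Bim + (Bm *m Bi - Bi *m Bm)) *m J.
Proof.
rewrite !(mulmxDl, mulmxDr, mulNmx, mulmxN) !mulmxA => E.
apply/matrixP => a b; move/matrixP/(_ a b): E.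
move: (J *m Am *m Ai) (Bm *m J *m Ai) (J *m Ami) (Bmi *m J) (Bi *m J *m Am)
  (Bi *m Bm *m J) (J *m Ai *m Am) (J *m Aim) (Bim *m J) (Bm *m Bi *m J).
move=> M1 M2 M3 M4 M5 M6 M7 M8 M9 M10; rewrite !mxE; lra.
Qed.

End CurvatureAlgebra.

Section Connection.
Context {R : realType} {n : nat}.
Implicit Types (g : 'rV[R]_n -> 'M[R]_n) (T : seq 'I_n -> R) (s : seq 'I_n).

(** Absorbing the prefix into the tensor yields [conn_corr_cons], a recursion among empty prefixes
    that suits induction on the index list. *)
Lemma conn_corr_pre g T x c pre s :
  conn_corr g T x c pre s = conn_corr g (fun u => T (pre ++ u)) x c [::] s.
Proof.
have H p1 p2 : conn_corr g T x c (p1 ++ p2) s = conn_corr g (fun u => T (p1 ++ u)) x c p2 s.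
  elim: s p2 => [|a s IH] p2 //=; rewrite rcons_cat IH; congr (_ + _).
  by apply: eq_bigr => e _; rewrite -catA.
by rewrite -[pre in LHS]cats0 H.
Qed.

Lemma conn_corr_cons g T x c a s : conn_corr g T x c [::] (a :: s) =
  \sum_e christoffel g e c a x * T (e :: s) + conn_corr g (fun u => T (a :: u)) x c [::] s.
Proof. by rewrite /= [in LHS]conn_corr_pre. Qed.

Lemma eq_conn_corr g T T' x c s : (forall u, size u = size s -> T u = T' u) ->
  conn_corr g T x c [::] s = conn_corr g T' x c [::] s.
Proof.
elim: s T T' => [|a s IH] T T' eT //; rewrite !conn_corr_cons; congr (_ + _).
  by apply: eq_bigr => e _; rewrite eT.
by apply: IH => u us; apply: eT; rewrite /= us.
Qed.

Lemma conn_corr_sum g (b : 'I_n -> R) (T : 'I_n -> seq 'I_n -> R) x c s :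
  conn_corr g (fun u => \sum_a b a * T a u) x c [::] s =
  \sum_a b a * conn_corr g (T a) x c [::] s.
Proof.
elim: s T => [|i s IH] T; first by rewrite big1 // => a _; rewrite /= mulr0.
rewrite conn_corr_cons IH.
under [RHS]eq_bigr do rewrite conn_corr_cons mulrDr.
rewrite big_split /=; congr (_ + _).
transitivity (\sum_e \sum_a christoffel g e c i x * (b a * T a (e :: s))).
  by apply: eq_bigr => e _; rewrite mulr_sumr.
rewrite exchange_big /=; apply: eq_bigr => a _; rewrite mulr_sumr.
by apply: eq_bigr => e _; rewrite mulrCA.
Qed.

End Connection.

(** * Naturality of connection, curvature and invariants *)

Section Naturality.
Context {R : realType} {n : nat}.
Local Notation V := 'rV[R]_n.
Variables (U : set V) (phi psi : V -> V) (g : V -> 'M[R]_n).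
Hypotheses (oU : open U)
  (sphi : forall a, smooth U (fun y => phi y 0 a)) (phiU : forall x, U x -> U (phi x))
  (spsi : forall a, smooth U (fun y => psi y 0 a)) (psiK : forall x, U x -> psi (phi x) = x)
  (sg : forall a b, smooth U (fun y => g y a b))
  (symg : forall x, U x -> (g x)^T = g x) (ug : forall x, U x -> g x \in unitmx).

Definition jacobian_mx (f : V -> V) x : 'M[R]_n :=
  \matrix_(a, i) partial i (fun y => f y 0 a) x.

Local Notation J := (jacobian_mx phi).
Local Notation h := (pullback phi g).

Lemma partial_coord (i k : 'I_n) x : partial i (fun y : V => y 0 k) x = (k == i)%:R.
Proof.
have := @derive_mx R V 1 n id x (ebasis R i) (@derivable_id _ _ _ _).
rewrite derive_id => /rowP/(_ k); rewrite !mxE eqxx /= => ->; exact: erefl.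
Qed.

(** By the chain rule for [psi \o phi], which is the identity on [U], the Jacobian of [psi] is a
    left inverse. *)
Lemma jacobian_unit x : U x -> J x \in unitmx.
Proof.
move=> Ux; suff /mulmx1_unit[] : jacobian_mx psi (phi x) *m J x = 1%:M by [].
apply/matrixP => k i; rewrite !mxE -(partial_coord i k x).
have <- : partial i ((fun y => psi y 0 k) \o phi) x = partial i (fun y => y 0 k) x.
  by apply: (eq_partial_open i oU Ux) => y Uy /=; rewrite psiK.
rewrite (partial_comp oU sphi phiU) //.
by apply: eq_bigr => a _; rewrite !mxE.
Qed.

Lemma smooth_jacobian a i : smooth U (fun y => J y a i).
Proof.
by apply: (smooth_ext oU (f := partial i (fun y => phi y 0 a))) => [y _|];
  [rewrite mxE|exact: smooth_partial].
Qed.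

Lemma pullbackE x : h x = (J x)^T *m g (phi x) *m J x.
Proof.
apply/matrixP => i j; rewrite !mxE exchange_big /=; apply: eq_bigr => b _.
rewrite !mxE mulr_suml; apply: eq_bigr => a _; rewrite !mxE.
by rewrite mulrAC.
Qed.

Lemma pullback_unit x : U x -> h x \in unitmx.
Proof. by move=> Ux; rewrite pullbackE !unitmx_mul unitmx_tr jacobian_unit // (ug (phiU Ux)). Qed.

Lemma smooth_pullback i j : smooth U (fun y => h y i j).
Proof.
apply: (smooth_ext oU (f := fun y => \sum_a \sum_b partial i (fun y => phi y 0 a) y *
  partial j (fun y => phi y 0 b) y * g (phi y) a b)) => [y _|]; first by rewrite mxE.
apply: smooth_sum => // a; apply: smooth_sum => // b; apply: smoothM => //.
  by apply: smoothM => //; exact: smooth_partial.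
exact: (smooth_comp oU sphi phiU (sg a b)).
Qed.

(** Inverts h = J^T g J. Together with [contract_pull] this is why full contractions do not see the
    Jacobian. *)
Lemma ginv_pullback x : U x -> J x *m ginv h x *m (J x)^T = ginv g (phi x).
Proof.
move=> Ux; have uJ := jacobian_unit Ux; have uh := pullback_unit Ux.
have E : g (phi x) *m (J x *m ginv h x *m (J x)^T) = 1%:M.
  apply: (can_inj (mulKmx (_ : (J x)^T \in unitmx))); first by rewrite unitmx_tr.
  by rewrite mulmx1 !mulmxA -pullbackE mulmxV // mul1mx.
by rewrite -[LHS](mulKmx (ug (phiU Ux))) E mulmx1.
Qed.

(** The right-hand side has the shape of [P] in [koszul]. *)
Lemma partial_pullback i k j x : U x -> partial i (fun y => h y k j) x =
  \sum_a \sum_b ((partial i (partial k (fun y => phi y 0 a)) x * J x b j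
      + J x a k * partial i (partial j (fun y => phi y 0 b)) x) * g (phi x) a b
   + J x a k * J x b j * \sum_c partial c (fun y => g y a b) (phi x) * J x c i).
Proof.
move=> Ux; pose d a k := partial k (fun y => phi y 0 a).
have dd a l : derivable (d a l) x (ebasis R i).
  exact: (smooth_derivable (smooth_partial l (sphi a)) Ux).
have dg a b : derivable ((fun y => g y a b) \o phi) x (ebasis R i).
  exact: (smooth_derivable (smooth_comp oU sphi phiU (sg a b)) Ux).
rewrite (_ : (fun y => _) = fun y => \sum_a \sum_b d a k y * d b j y *
    ((fun y => g y a b) \o phi) y); last by apply/funext => y; rewrite mxE.
rewrite partial_sum => [|a]; last first.
  by apply: derivable_bigsum => b; apply: derivableM => //; apply: derivableM.
apply: eq_bigr => a _; rewrite partial_sum => [|b]; last first.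
  by apply: derivableM => //; apply: derivableM.
apply: eq_bigr => b _; rewrite partialM //; last exact: derivableM.
rewrite partialM // (partial_comp oU sphi phiU) // !mxE; congr (_ + _ * _).
by apply: eq_bigr => c _; rewrite mxE.
Qed.

Lemma partial_jacobian i j a x : U x ->
  partial i (partial j (fun y => phi y 0 a)) x =
  \sum_k J x a k * christoffel h k i j x
  - \sum_b \sum_c J x b i * J x c j * christoffel g a b c (phi x).
Proof.
move=> Ux; pose H i j a := partial i (partial j (fun y => phi y 0 a)) x.
have Hsym p q : H p q = H q p.
  by apply/funext => e; exact: (@smooth_partialC R n U oU _ p q x (sphi e) Ux).
have gsym p q : g (phi x) p q = g (phi x) q p by rewrite -{1}(symg (phiU Ux)) mxE.
(* The claim reads X = J Y. Multiplied by the invertible J^T g, the right side becomes h Y, the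
   Christoffel symbols of the first kind of [h], which [koszul] expands into the left side. *)
pose X := \col_e (H i j e + \sum_b \sum_c J x b i * J x c j * christoffel g e b c (phi x)).
have XE e : X e 0 = H i j e + \sum_b \sum_c J x b i * J x c j * christoffel g e b c (phi x).
  by rewrite [LHS]mxE.
pose Y := \col_k christoffel h k i j x.
suff E : X = J x *m Y.
  have := congr1 (fun M : 'cV[R]_n => M a 0) E.
  rewrite /= XE [RHS]mxE => /(canRL (addrK _)) E2; rewrite -[LHS]/(H i j a) E2.
  by congr (_ - _); apply: eq_bigr => k _; rewrite [Y k 0]mxE.
have uG : (J x)^T *m g (phi x) \in unitmx.
  by rewrite unitmx_mul unitmx_tr jacobian_unit // (ug (phiU Ux)).
rewrite -[X](mulKmx uG) -[J x *m Y](mulKmx uG); congr (_ *m _); rewrite mulmxA -pullbackE.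
apply/colP => k; rewrite mxE [RHS]mxE.
transitivity (\sum_l h x k l * christoffel h l i j x); last first.
  by apply: eq_bigr => l _; rewrite [Y l 0]mxE.
rewrite mul_metric_christoffel; last exact: pullback_unit.
rewrite !partial_pullback //.
have := @koszul R n H (J x) (g (phi x))
  (fun a b c => partial c (fun y => g y a b) (phi x)) i j k Hsym gsym.
rewrite /= => ->; rewrite mulr_sumr.
transitivity (\sum_a J x a k * \sum_b g (phi x) a b * X b 0).
  under eq_bigr do rewrite !mxE mulr_suml.
  rewrite exchange_big /=; apply: eq_bigr => c _; rewrite mulr_sumr.
  by apply: eq_bigr => b _; rewrite !mxE mulrA.
apply: eq_bigr => c _; rewrite mulrCA; congr (_ * _).
rewrite mulrDr mulKf ?pnatr_eq0 //; under [LHS]eq_bigr do rewrite XE mulrDr.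
rewrite [LHS]big_split /=; congr (_ + _).
transitivity (\sum_b \sum_d J x b i * J x d j *
  \sum_e g (phi x) c e * christoffel g e b d (phi x)).
  under eq_bigr do rewrite mulr_sumr.
  rewrite exchange_big /=; apply: eq_bigr => b _.
  under eq_bigr do rewrite mulr_sumr.
  rewrite exchange_big /=; apply: eq_bigr => d _.
  by rewrite mulr_sumr; apply: eq_bigr => e _; rewrite mulrCA.
rewrite mulr_sumr; apply: eq_bigr => b _; rewrite mulr_sumr; apply: eq_bigr => d _.
rewrite mul_metric_christoffel; last by rewrite (ug (phiU Ux)).
by rewrite mulrCA.
Qed.


Definition natural_tensor k (S' S : V -> seq 'I_n -> R) : Prop :=
  forall x s, U x -> size s = k -> S' x s = pull (J x) (S (phi x)) s.

Lemma smooth_pull (S : V -> seq 'I_n -> R) s : (forall u, smooth U (fun y => S y u)) ->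
  smooth U (fun y => pull (J y) (S (phi y)) s).
Proof.
elim: s S => [|i s IH] S sS; first exact: (smooth_comp oU sphi phiU (sS [::])).
apply: smooth_sum => // a; apply: smoothM => //; first exact: smooth_jacobian.
exact: (IH (fun y u => S y (a :: u))).
Qed.

(* The two connection terms are the derivatives of the Jacobian factors, rewritten
   by partial_jacobian. *)
Lemma partial_pull (S : V -> seq 'I_n -> R) c s x :
  (forall u, smooth U (fun y => S y u)) -> U x ->
  partial c (fun y => pull (J y) (S (phi y)) s) x =
  \sum_d J x d c * pull (J x) (fun u => partial d (fun y => S y u) (phi x)) s
  + (conn_corr h (pull (J x) (S (phi x))) x c [::] s
     - \sum_d J x d c * pull (J x) (fun u => conn_corr g (S (phi x)) (phi x) d [::] u) s).
Proof.
move=> + Ux; elim: s S => [|i s IH] S sS.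
  rewrite [LHS](partial_comp oU sphi phiU c (sS [::])) //= [X in _ - X]big1 => [|d _].
    by rewrite subr0 addr0; apply: eq_bigr => a _; rewrite mxE mulrC.
  by rewrite mulr0.
pose Sa a := fun y u => S y (a :: u).
pose p a := pull (J x) (Sa a (phi x)) s.
have dJ a : derivable (fun y => J y a i) x (ebasis R c).
  exact: (smooth_derivable (smooth_jacobian a i) Ux).
have dp a : derivable (fun y => pull (J y) (Sa a (phi y)) s) x (ebasis R c).
  by apply: (smooth_derivable _ Ux); apply: smooth_pull => u; exact: sS.
have -> : partial c (fun y => pull (J y) (S (phi y)) (i :: s)) x =
    \sum_a (partial c (fun y => J y a i) x * p a +
      J x a i * partial c (fun y => pull (J y) (Sa a (phi y)) s) x).
  rewrite [LHS]partial_sum => [|a]; last exact: (derivableM (dJ a) (dp a)).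
  by apply: eq_bigr => a _; exact: (partialM (dJ a) (dp a)).
have HJ a : partial c (fun y => J y a i) x = \sum_k J x a k * christoffel h k c i x
  - \sum_d \sum_e J x d c * J x e i * christoffel g a d e (phi x).
  rewrite -partial_jacobian //; congr partial; apply/funext => y; by rewrite mxE.
have IHa a := IH (Sa a) (fun u => sS (a :: u)).
under [LHS]eq_bigr do rewrite IHa HJ.
rewrite conn_corr_cons.
have -> : conn_corr h (fun u => pull (J x) (S (phi x)) (i :: u)) x c [::] s =
    \sum_a J x a i * conn_corr h (pull (J x) (Sa a (phi x))) x c [::] s.
  exact: (conn_corr_sum h (fun a => J x a i) (fun a => pull (J x) (Sa a (phi x)))).
have -> : \sum_e christoffel h e c i x * pull (J x) (S (phi x)) (e :: s) =
    \sum_a (\sum_k J x a k * christoffel h k c i x) * p a.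
  under [RHS]eq_bigr do rewrite mulr_suml.
  rewrite exchange_big /=; apply: eq_bigr => e _; rewrite mulr_sumr.
  by apply: eq_bigr => a _; rewrite mulrA [christoffel _ _ _ _ _ * _]mulrC.
have E d : pull (J x) (fun u => conn_corr g (S (phi x)) (phi x) d [::] u) (i :: s) =
    \sum_a J x a i * (\sum_e christoffel g e d a (phi x) * p e)
    + \sum_a J x a i * pull (J x) (fun u => conn_corr g (Sa a (phi x)) (phi x) d [::] u) s.
  rewrite -big_split; apply: eq_bigr => a _ /=; rewrite -mulrDr; congr (_ * _).
  rewrite -pull_sum -pullD; apply: eq_pull => u _; exact: conn_corr_cons.
rewrite (eq_bigr _ (fun d _ => congr1 (fun r => J x d c * r) (E d))) /=.
under [X in _ = _ + (_ - X)]eq_bigr do rewrite mulrDr.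
rewrite [X in _ = _ + (_ - X)]big_split /=.
have -> : \sum_d J x d c * (\sum_a J x a i * (\sum_e christoffel g e d a (phi x) * p e)) =
    \sum_a (\sum_d \sum_e J x d c * J x e i * christoffel g a d e (phi x)) * p a.
  under [RHS]eq_bigr do rewrite mulr_suml.
  rewrite exchange_big /=; apply: eq_bigr => d _.
  under [RHS]eq_bigr do rewrite mulr_suml.
  rewrite exchange_big /= mulr_sumr; apply: eq_bigr => a _.
  by rewrite !mulr_sumr; apply: eq_bigr => e _; rewrite !mulrA.
have exch (B : 'I_n -> 'I_n -> R) : \sum_d J x d c * (\sum_a J x a i * B d a) =
    \sum_a J x a i * \sum_d J x d c * B d a.
  under eq_bigr do rewrite mulr_sumr.
  rewrite exchange_big; apply: eq_bigr => a _ /=; rewrite mulr_sumr.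
  by apply: eq_bigr => d _; rewrite mulrCA.
have /= exch1 := exch (fun d a =>
  pull (J x) (fun u => partial d (fun y => S y (a :: u)) (phi x)) s).
have /= exch2 := exch (fun d a =>
  pull (J x) (fun u => conn_corr g (Sa a (phi x)) (phi x) d [::] u) s).
rewrite exch1 exch2.
rewrite opprD !addrA -!sumrN -!big_split /=; apply: eq_bigr => a _.
by ring.
Qed.

(** The connection terms of [h] produced by [partial_pull] are exactly those that [covd h]
    subtracts; what remains is the pullback of [covd g]. *)
Lemma natural_covd k (S' S : V -> seq 'I_n -> R) :
  (forall u, smooth U (fun y => S y u)) -> natural_tensor k S' S ->
  natural_tensor k.+1 (covd h S') (covd g S).
Proof.
move=> sS nS x [|c s] // Ux [sk].
have -> : covd h S' x (c :: s) = partial c (fun y => pull (J y) (S (phi y)) s) x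
    - conn_corr h (pull (J x) (S (phi x))) x c [::] s.
  congr (_ - _); last by apply: eq_conn_corr => u us; rewrite nS // us.
  by apply: (eq_partial_open c oU Ux) => y Uy; rewrite nS.
rewrite partial_pull //.
transitivity (\sum_d J x d c * pull (J x) (fun u => partial d (fun y => S y u) (phi x)) s
  - \sum_d J x d c * pull (J x) (fun u => conn_corr g (S (phi x)) (phi x) d [::] u) s).
  by ring.
rewrite -sumrB; apply: eq_bigr => d _; rewrite -mulrBr; congr (_ * _).
rewrite -mulN1r -pullZ -pullD; apply: eq_pull => u _.
by rewrite mulN1r.
Qed.

Lemma smooth_christoffel_mx (f : V -> 'M[R]_n) : (forall a b, smooth U (fun y => f y a b)) ->
  (forall x, U x -> f x \in unitmx) -> forall i, smooth_mx U (christoffel_mx f i).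
Proof.
move=> sf uf i a b; apply: (smooth_ext oU (f := christoffel f a i b)) => [y _|].
  by rewrite mxE.
exact: (smooth_family_christoffel oU (G := fun=> f) sf (fun=> uf)).
Qed.


Definition pulled_connection i x : 'M[R]_n :=
  \sum_b J x b i *: christoffel_mx g b (phi x).

Lemma mpartial_jacobian i x : U x ->
  mpartial i J x = J x *m christoffel_mx h i x - pulled_connection i x *m J x.
Proof.
move=> Ux; apply/matrixP => a j; rewrite [LHS]mxE.
have -> : (fun y => J y a j) = partial j (fun y => phi y 0 a).
  by apply/funext => y; rewrite mxE.
rewrite partial_jacobian // [RHS]mxE [X in _ = _ + X]mxE; congr (_ - _).
  by rewrite mxE; apply: eq_bigr => k _; congr (_ * _); rewrite mxE.
rewrite [RHS]mxE exchange_big /=; apply: eq_bigr => c _.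
rewrite summxE mulr_suml; apply: eq_bigr => b _.
by rewrite !mxE mulrAC.
Qed.

Lemma smooth_pulled_connection i : smooth_mx U (pulled_connection i).
Proof.
move=> a c; apply: (smooth_ext oU
  (f := fun y => \sum_b J y b i * (christoffel g a b c \o phi) y)) => [y _|].
  by rewrite summxE; apply: eq_bigr => b _; rewrite !mxE.
apply: smooth_sum => // b; apply: smoothM => //; first exact: smooth_jacobian.
apply: (smooth_comp oU sphi phiU); have := smooth_christoffel_mx sg ug b a c.
by apply: smooth_ext => // y _; rewrite mxE.
Qed.

(** Separates the second derivatives of [phi], which are symmetric in [m] and [i], from the part
    that contributes to the curvature. *)
Lemma mpartial_pulled_connection m i x : U x ->
  mpartial m (pulled_connection i) x =
  \sum_b partial m (fun y => J y b i) x *: christoffel_mx g b (phi x)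
  + \sum_b \sum_c (J x c m * J x b i) *: mpartial c (christoffel_mx g b) (phi x).
Proof.
move=> Ux; apply/matrixP => a d; rewrite mxE [RHS]mxE !summxE -big_split /=.
have sc b : smooth U (christoffel g a b d).
  by have := smooth_christoffel_mx sg ug b a d; apply: smooth_ext => // y _; rewrite mxE.
rewrite (_ : (fun y => _) = fun y => \sum_b J y b i * (christoffel g a b d \o phi) y); last first.
  by apply/funext => y; rewrite summxE; apply: eq_bigr => b _; rewrite !mxE.
have dJ b : derivable (fun y => J y b i) x (ebasis R m).
  exact: (smooth_derivable (smooth_jacobian b i) Ux).
have dc b : derivable (christoffel g a b d \o phi) x (ebasis R m).
  exact: (smooth_derivable (smooth_comp oU sphi phiU (sc b)) Ux).
rewrite partial_sum => [|b]; last exact: (derivableM (dJ b) (dc b)).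
apply: eq_bigr => b _; rewrite partialM // (partial_comp oU sphi phiU) //.
rewrite [in RHS]mxE [christoffel_mx _ _ _ _ _]mxE; congr (_ + _).
rewrite mulr_sumr summxE; apply: eq_bigr => c _.
rewrite [RHS]mxE [X in _ = _ * X]mxE.
have -> : (fun y => christoffel_mx g b y a d) = christoffel g a b d.
  by apply/funext => y; rewrite mxE.
by rewrite [J x c m]mxE; ring.
Qed.

Lemma curvature_jacobian m i x : U x -> J x *m curvature_mx h m i x =
  (\sum_c \sum_d (J x c m * J x d i) *: curvature_mx g c d (phi x)) *m J x.
Proof.
move=> Ux.
have sJ : smooth_mx U J by exact: smooth_jacobian.
have sA : forall k, smooth_mx U (christoffel_mx h k).
  by apply: smooth_christoffel_mx; [exact: smooth_pullback|exact: pullback_unit].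
have D2 k l : mpartial k (mpartial l J) x =
   (J x *m christoffel_mx h k x - pulled_connection k x *m J x) *m christoffel_mx h l x
   + J x *m mpartial k (christoffel_mx h l) x
   - (mpartial k (pulled_connection l) x *m J x
      + pulled_connection l x *m (J x *m christoffel_mx h k x - pulled_connection k x *m J x)).
  rewrite (eq_mpartial oU k (fun y => @mpartial_jacobian l y)) //.
  have sB := smooth_pulled_connection l.
  rewrite (mpartialB k (smooth_mxM oU sJ (sA l)) (smooth_mxM oU sB sJ) Ux).
  by rewrite (mpartialM k sJ (sA l) Ux) (mpartialM k sB sJ Ux) !mpartial_jacobian.
have dJ k l b : partial k (fun y => J y b l) x = partial l (fun y => J y b k) x.
  have E q : (fun y => J y b q) = partial q (fun y => phi y 0 b).
    by apply/funext => y; rewrite mxE.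
  by rewrite !E; exact: (@smooth_partialC R n U oU _ k l x (sphi b) Ux).
(* The integrability condition that [curvature_conjugation] turns into the law for the curvature. *)
have SW : mpartial m (mpartial i J) x = mpartial i (mpartial m J) x.
  apply/matrixP => a b; rewrite [LHS]mxE [RHS]mxE.
  have E q : (fun y => mpartial q J y a b) = partial q (fun y => J y a b).
    by apply/funext => y; rewrite mxE.
  rewrite (congr1 (fun f => partial m f x) (E i)) (congr1 (fun f => partial i f x) (E m)).
  exact: (@smooth_partialC R n U oU _ m i x (sJ a b) Ux).
rewrite !D2 in SW; rewrite (curvature_conjugation SW); congr (_ *m _).
rewrite !mpartial_pulled_connection //.
(* By symmetry the sums with second derivatives of [phi] coincide, so they cancel in the
   difference. *)
under [X in _ - (X + _)]eq_bigr do rewrite dJ.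
rewrite [X in X - _ + _]addrC addrKA.
transitivity (\sum_c \sum_d ((J x c m * J x d i) *: mpartial c (christoffel_mx g d) (phi x)
  - (J x c m * J x d i) *: mpartial d (christoffel_mx g c) (phi x)
  + ((J x c m * J x d i) *: (christoffel_mx g c (phi x) *m christoffel_mx g d (phi x))
  - (J x c m * J x d i) *: (christoffel_mx g d (phi x) *m christoffel_mx g c (phi x)))));
  last first.
  by apply: eq_bigr => c _; apply: eq_bigr => d _; rewrite -!scalerBr -scalerDr.
have PP k l : pulled_connection k x *m pulled_connection l x = \sum_c \sum_d
    (J x c k * J x d l) *: (christoffel_mx g c (phi x) *m christoffel_mx g d (phi x)).
  rewrite mulmx_suml; apply: eq_bigr => c _; rewrite mulmx_sumr; apply: eq_bigr => d _.
  by rewrite -scalemxAl -scalemxAr scalerA.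
rewrite !PP [X in X - _ + _]exchange_big [X in _ + (_ - X)]exchange_big /=.
rewrite -!sumrB -big_split; apply: eq_bigr => c _ /=.
rewrite -!sumrB -big_split; apply: eq_bigr => d _ /=.
by rewrite [J x d i * _]mulrC.
Qed.

(** The factor [J] in h = J^T g J passes through the curvature matrix by [curvature_jacobian]; J^T
    and the [J] that comes out on the right account for the first two slots, the double sum for the
    last two. *)
Lemma natural_riemann : natural_tensor 4 (riemann h) (riemann g).
Proof.
move=> x [|a [|b [|c [|d [|? ?]]]]] // Ux _; rewrite riemannE /=.
rewrite {1}pullbackE -mulmxA curvature_jacobian // mulmxA mxE.
rewrite (eq_bigr (fun b' => \sum_a' J x a' a * (J x b' b * \sum_c' \sum_d'
   J x c' c * (J x d' d * riemann g (phi x) [:: a'; b'; c'; d'])))) => [|b' _].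
  rewrite exchange_big; apply: eq_bigr => a' _; rewrite mulr_sumr /=.
  apply: eq_bigr => b' _; congr (_ * (_ * _)).
  by apply: eq_bigr => c' _; rewrite mulr_sumr.
rewrite -mulmxA mxE mulr_suml; apply: eq_bigr => a' _.
rewrite [(J x)^T _ _]mxE -mulrA; congr (_ * _); rewrite mulrC; congr (_ * _).
rewrite mulmx_sumr summxE; apply: eq_bigr => c' _.
rewrite mulmx_sumr summxE; apply: eq_bigr => d' _.
by rewrite -scalemxAr mxE riemannE mulrA.
Qed.

Lemma smooth_nabla_riemann m s : smooth U (fun y => nabla_riemann g m y s).
Proof. exact: (smooth_family_nabla_riemann oU (G := fun=> g) sg (fun=> ug)). Qed.

Lemma natural_nabla_riemann m :
  natural_tensor (4 + m) (nabla_riemann h m) (nabla_riemann g m).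
Proof.
elim: m => [|m IH]; first exact: natural_riemann.
by rewrite addnS; apply: natural_covd => // u; exact: smooth_nabla_riemann.
Qed.

Lemma natural_factors ms x s : U x -> size s = rk ms ->
  factors h x ms s = pull (J x) (factors g (phi x) ms) s.
Proof.
move=> Ux; elim: ms s => [|m ms IH] s; first by move/size0nil => ->.
rewrite /rk /= -/(rk ms) => ss.
have ms_s : (4 + m <= size s)%N by rewrite ss leq_addr.
rewrite (pull_cat (J x) (nabla_riemann g m (phi x)) (factors g (phi x) ms) ms_s).
rewrite natural_nabla_riemann // ?IH // ?size_takel //.
by rewrite size_drop ss addKn.
Qed.

Lemma natural_eval_contraction (C : Defs.contraction) x : U x -> wf_contraction C ->
  eval_contraction h C x = eval_contraction g C (phi x).
Proof.
move=> Ux wfC; rewrite /eval_contraction.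
transitivity (\sum_(t : (rk (c_orders C)).-tuple 'I_n)
   (\prod_(j : 'I_(rk (c_orders C)) | (j < c_pairing C j)%N)
      ginv h x (tnth t j) (tnth t (c_pairing C j)))
   * pull (J x) (factors g (phi x) (c_orders C)) t).
  by apply: eq_bigr => t _; rewrite natural_factors // size_tuple.
by rewrite (contract_pull wfC) ginv_pullback.
Qed.

Lemma natural_eval_invariant (P : curv_invariant R) x : U x -> wf_invariant P ->
  eval_invariant P h x = eval_invariant P g (phi x).
Proof.
move=> Ux; rewrite /eval_invariant; elim: P => [|[r Cs] P IH] wfP; first by rewrite !big_nil.
rewrite !big_cons IH => [|mon monP]; last by apply: wfP; right.
congr (_ * _ + _); have := wfP (r, Cs) (or_introl erefl) => /=.
elim: Cs {wfP} => [|C Cs IHC] wfC; first by rewrite !big_nil.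
rewrite !big_cons natural_eval_contraction //; last by apply: wfC; left.
by rewrite IHC // => C' C'in; apply: wfC; right.
Qed.

End Naturality.

Theorem theorem2 (R : realType) (n : nat) (U : set 'rV[R]_n)
  (g g0 : 'rV[R]_n -> 'M[R]_n) (p : 'rV[R]_n)
  (phi : R -> 'rV[R]_n -> 'rV[R]_n) :
  open U -> U p ->
  metric_on U g -> metric_on U g0 ->
  (forall tau : R, diffeo_on U (phi tau)) ->
  (forall tau : R, phi tau p = p) ->
  (forall (l : seq 'I_n) (i j : 'I_n) (x : 'rV[R]_n), U x ->
     (fun tau : R => iterpartial l (fun y => pullback (phi tau) g y i j) x)
       @ +oo --> iterpartial l (fun y => g0 y i j) x) ->
  forall P : curv_invariant R, wf_invariant P ->
    eval_invariant P g p = eval_invariant P g0 p.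
Proof.
move=> oU Up [sg mg] [sg0 mg0] dphi phip cvg_phi P wfP.
have sg' a b : smooth U (fun y => g y a b) by exact/smooth_on_smooth/sg.
have symg x (Ux : U x) := (mg x Ux).1; have ug x (Ux : U x) := (mg x Ux).2.
(* [None] carries the limit metric, and the filter [Some @ +oo] sees only the pullbacks, so
   convergence towards the value at [None] is the hypothesis on the metrics. *)
pose G (t : option R) := if t is Some tau then pullback (phi tau) g else g0.
pose F : set_system (option R) := Some @ +oo.
have sphi tau a : smooth U (fun y => phi tau y 0 a).
  by have [s _] := dphi tau; exact/smooth_on_smooth/s.
have sG a b : smooth_family U F None (fun t x => G t x a b).
  apply: smooth_family_on => [[tau|]|l x Ux]; [|exact: sg0|exact: cvg_phi].
  have [_ [phiU _]] := dphi tau.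
  exact/smooth_smooth_on/(smooth_pullback oU (sphi tau) phiU sg').
have natural tau : eval_invariant P (G (Some tau)) p = eval_invariant P g p.
  have [_ [phiU [psi [spsi _ psiK _]]]] := dphi tau.
  rewrite -[in RHS](phip tau) (natural_eval_invariant oU (sphi tau) phiU _ psiK sg' symg ug) //.
  by move=> a; exact/smooth_on_smooth/spsi.
have uG t x : U x -> G t x \in unitmx.
  move=> Ux; case: t => [tau|]; last by have [] := mg0 x Ux.
  have [_ [phiU [psi [spsi _ psiK _]]]] := dphi tau.
  apply: (pullback_unit oU (sphi tau) phiU _ psiK ug Ux) => a.
  exact/smooth_on_smooth/spsi.
have L := smooth_family_cvg (smooth_family_invariant oU sG uG P) Up.
have {}L : eval_invariant P (G (Some tau)) p @[tau --> +oo] --> eval_invariant P g0 p.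
  exact: L.
have E : (fun tau => eval_invariant P (G (Some tau)) p) = fun=> eval_invariant P g p.
  by apply/funext.
rewrite E in L; apply: cvg_unique L => //; exact: cvg_cst.
Qed.
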